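(* Let $Q=Q_n$ be the Metropolized random transposition walk on the set $D_n$ of derangements of $\{1,\dots,n\}$ (as defined in the context). Then, as $n\to\infty$, its spectral gap satisfies $$1-\beta_1(Q)=\Omega\left(\frac1n\right)$$ and its log-Sobolev constant satisfies $$\alpha(Q)=\Omega\left(\frac1{n\log(n)}\right).$$ That is, there are constants $c>0$ and $n_0$ such that $1-\beta_1(Q_n)\ge\frac cn$ and $\alpha(Q_n)\ge\frac c{n\log n}$ for all $n\ge n_0$.
   Context: A permutation $\sigma\in S_n$ is a derangement if $\sigma(i)\ne i$ for all $i$. Let $d=\binom n2$; write $x\sim y$ for $x,y\in S_n$ when $y^{-1}x$ is a transposition. The kernel $Q$ on $D_n$: $Q(x,y)=\frac1{2d}$ if $x\sim y$ with $x,y\in D_n$, $Q(x,x)=1-\frac1{2d}|\{y\in D_n:y\sim x\}|$, and $0$ otherwise; it is reversible with respect to the uniform distribution on $D_n$. For a reversible kernel $P$ on a finite set $X$ with stationary distribution $\pi$, let $1=\beta_0(P)\ge\beta_1(P)\ge\cdots$ be its eigenvalues. Define $\mathcal{E}_P(f,f)=\frac12\sum_{x,y\in X}|f(x)-f(y)|^2P(x,y)\pi(x)$, $V_\pi(f)=\frac12\sum_{x,y\in X}|f(x)-f(y)|^2\pi(x)\pi(y)$, $\|f\|_{2,\pi}^2=\sum_x|f(x)|^2\pi(x)$, and $L_\pi(f)=\sum_{x\in X}|f(x)|^2\log\left(\frac{f(x)^2}{\|f\|_{2,\pi}^2}\right)\pi(x)$ (with $0\log0=0$). Then $1-\beta_1(P)=\inf\mathcal{E}_P(f,f)/V_\pi(f)$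 over $f$ with $V_\pi(f)\neq0$, and the log-Sobolev constant is $\alpha(P)=\inf\mathcal{E}_P(f,f)/L_\pi(f)$ over $f$ with $L_\pi(f)\ne0$. *)

(* Defs.v *)
(* MathComp + MathComp-Analysis; reals are an arbitrary [R : realType]. *)
From mathcomp Require Import all_boot all_order all_algebra all_fingroup.
From mathcomp Require Import polyrcf.
From mathcomp Require Import all_classical all_reals all_analysis.

Set Implicit Arguments.
Unset Strict Implicit.
Unset Printing Implicit Defensive.

Import Order.TTheory GRing.Theory Num.Theory.

Local Open Scope classical_set_scope.
Local Open Scope ring_scope.

Definition kernel_mx (R : realType) (X : finType) (P : X -> X -> R) :
    'M[R]_#|X| :=
  \matrix_(i, j) P (enum_val i) (enum_val j).

(* The real eigenvalues of [P], in nonincreasing order and repeated according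
   to their algebraic multiplicity. When [P] is reversible with respect to a
   positive distribution, these are all the [#|X|] eigenvalues of [P]. *)
Definition eigenvalues (R : realType) (X : finType) (P : X -> X -> R) : seq R :=
  let p := char_poly (kernel_mx P) in
  sort >=%R (flatten [seq nseq (mup x p) x | x <- rootsR p]).

(* Indexed from 0, so that [beta P 0 = 1] for a reversible Markov kernel. *)
Definition beta (R : realType) (X : finType) (P : X -> X -> R) (j : nat) : R :=
  nth 0 (eigenvalues P) j.

Definition spectral_gap (R : realType) (X : finType) (P : X -> X -> R) : R :=
  1 - beta P 1.

Definition dirichlet (R : realType) (X : finType) (P : X -> X -> R)
    (pi : X -> R) (f : X -> R) : R :=
  2^-1 * \sum_(x : X) \sum_(y : X) `|f x - f y| ^+ 2 * P x y * pi x.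

Definition sqnorm2 (R : realType) (X : finType) (pi f : X -> R) : R :=
  \sum_(x : X) `|f x| ^+ 2 * pi x.

(* [0 log 0 = 0] holds here because [ln 0 = 0]. *)
Definition entropy2 (R : realType) (X : finType) (pi f : X -> R) : R :=
  \sum_(x : X) `|f x| ^+ 2 * ln (f x ^+ 2 / sqnorm2 pi f) * pi x.

(* [inf] is the infimum in [R]: the set is bounded below by 0 when [P] and [pi]
   are nonnegative and [pi] has total mass 1; it is nonempty when moreover [pi]
   is positive and [X] has at least two points. *)
Definition log_sobolev (R : realType) (X : finType) (P : X -> X -> R)
    (pi : X -> R) : R :=
  inf [set r | exists2 f : X -> R,
                 entropy2 pi f != 0 & r = dirichlet P pi f / entropy2 pi f].

Definition uniform_dist (R : realType) (X : finType) (x : X) : R :=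
  #|X|%:R^-1.

Definition is_derangement (n : nat) (s : 'S_n) : bool :=
  [forall i, s i != i].

Notation derangement n := {s : 'S_n | is_derangement s}.

Definition is_transposition (n : nat) (s : 'S_n) : bool :=
  [exists i, exists j, (i != j) && (s == tperm i j)].

(* Permutations are multiplied from left to right, so that [x * y^-1] is the
   function [i |-> y^-1 (x i)], i.e. the composite "y^-1 after x". *)
Definition transp_adj (n : nat) (x y : 'S_n) : bool :=
  is_transposition (x * y^-1)%g.

Definition Q (R : realType) (n : nat) (x y : derangement n) : R :=
  let d : R := 'C(n, 2)%:R in
  if x == y then
    1 - (2 * d)^-1 * #|[pred z : derangement n | transp_adj (val z) (val x)]|%:R
  else if transp_adj (val x) (val y) then (2 * d)^-1
  else 0.

(* Main.v *)
Require Import Defs.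
From mathcomp Require Import all_boot all_order all_algebra all_fingroup.
From mathcomp Require Import polyrcf.
From mathcomp Require Import all_classical all_reals all_analysis.
From mathcomp Require Import ring lra.

(* Both inequalities are first proved for random transpositions on the whole
   symmetric group, by induction on the degree: conditioning on the value of
   [s i] and averaging over [i] gives an exact recursion for the transposition
   energy, and the law of [s i] is handled by the corresponding inequality on the
   complete graph.  They are then transferred to derangements by extending a
   function from derangements to all permutations, removing one constraint
   [s k != k] at a time: a permutation fixing [k] receives the average of the
   values at its products with the transpositions [(k j)], and this multiplies
   the energy by at most [1 + O(1/n)].  Since variance and entropy are infima over
   a constant of sums of nonnegative terms, they can only grow, when left
   unnormalized, on passing from derangements to all permutations. *)

Set Implicit Arguments.
Unset Strict Implicit.
Unset Printing Implicit Defensive.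

Import Order.TTheory GRing.Theory Num.Theory.

Local Open Scope ring_scope.

(** * Sums, entropy and the complete graph *)

Section RealSums.
Context {R : realType}.
Implicit Types (I : finType) (x y c m : R).

(** Lagrange's identity. It gives Cauchy-Schwarz and, with [v] constant, the pairwise form of the
    variance. *)
Lemma sumr_pair_diff I (P : pred I) (u v : I -> R) :
  \sum_(i | P i) \sum_(j | P j) (u i * v j - u j * v i) ^+ 2 =
  2 * ((\sum_(i | P i) u i ^+ 2) * (\sum_(i | P i) v i ^+ 2) -
       (\sum_(i | P i) u i * v i) ^+ 2).
Proof.
transitivity (\sum_(i | P i) (u i ^+ 2 * \sum_(j | P j) v j ^+ 2
   + v i ^+ 2 * (\sum_(j | P j) u j ^+ 2)
   - 2 * (u i * v i) * \sum_(j | P j) u j * v j)).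
  apply: eq_bigr => i _; rewrite !mulr_sumr -sumrN -!big_split /=.
  by apply: eq_bigr => j _; ring.
by rewrite !big_split /= sumrN -!mulr_suml -mulr_sumr; ring.
Qed.

Lemma cauchy_schwarz_sum I (P : pred I) (u v : I -> R) :
  (\sum_(i | P i) u i * v i) ^+ 2 <=
  (\sum_(i | P i) u i ^+ 2) * (\sum_(i | P i) v i ^+ 2).
Proof.
rewrite -subr_ge0 -(@pmulr_rge0 _ 2) // -sumr_pair_diff.
by do 2!apply: sumr_ge0 => ? _; apply: sqr_ge0.
Qed.

Lemma sqr_sum_le I (P : pred I) (u : I -> R) :
  (\sum_(i | P i) u i) ^+ 2 <= #|P|%:R * \sum_(i | P i) u i ^+ 2.
Proof.
have := cauchy_schwarz_sum P u (fun=> 1).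
rewrite mulrC (eq_bigr u) => [|i _]; last by rewrite mulr1.
by under [X in _ <= X * _ -> _]eq_bigr do rewrite expr1n; rewrite sumr_const.
Qed.

Lemma sum_pair_sqr_diff I (u : I -> R) :
  \sum_i \sum_j (u i - u j) ^+ 2 =
  2 * (#|I|%:R * (\sum_i u i ^+ 2) - (\sum_i u i) ^+ 2).
Proof.
have := sumr_pair_diff predT u (fun=> 1).
under eq_bigr do under eq_bigr do rewrite !mulr1.
under [X in _ = 2 * (_ * X - _)]eq_bigr do rewrite expr1n.
under [X in _ = 2 * (_ - X ^+ 2)]eq_bigr do rewrite mulr1.
by rewrite sumr_const [_ * _%:R]mulrC.
Qed.

Lemma ln_le_sub1 x : 0 < x -> ln x <= x - 1.
Proof.
move=> x0; rewrite -[X in ln X](subrK 1) addrC.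
by rewrite le_ln1Dx // ltrBrDl subrr.
Qed.

(** Multiply [ln (c / x) <= c / x - 1] by [x]; at [x = 0] only [c] remains. *)
Lemma entropy_integrand_ge0 x c : 0 <= x -> 0 < c ->
  0 <= x * ln x - x * ln c - x + c.
Proof.
rewrite le_eqVlt => /predU1P[<- /ltW c0|x0 c0]; first by rewrite !mul0r; lra.
have := ln_le_sub1 (divr_gt0 c0 x0); rewrite ln_div // => /(ler_wpM2l (ltW x0)).
by rewrite !mulrBr mulrCA mulfV ?gt_eqF //; lra.
Qed.

(** This is [#|P|] times the entropy of [q] under the uniform law on [P]. Left unnormalized, it is
    monotone in [P] for nonnegative [q]. *)
Definition entropy I (P : pred I) (q : I -> R) : R :=
  \sum_(i | P i) q i * ln (q i) -
  (\sum_(i | P i) q i) * ln ((\sum_(i | P i) q i) / #|P|%:R).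

(** The right side minus the left is [#|P|] times the nonnegative integrand of
    [entropy_integrand_ge0], taken at the mean of [q]. *)
Lemma entropy_le I (P : pred I) (q : I -> R) c :
  (forall i, 0 <= q i) -> 0 < c ->
  entropy P q <= \sum_(i | P i) (q i * ln (q i) - q i * ln c - q i + c).
Proof.
move=> q0 c0; rewrite /entropy !big_split /= !sumrN -mulr_suml sumr_const.
set S := \sum_(i | P i) q i; have S0 : 0 <= S by apply: sumr_ge0.
have [p0|p0] := eqVneq #|P| 0%N.
  have -> : S = 0 by rewrite /S big_pred0 // => i; exact: card0_eq p0 i.
  by rewrite p0 /=; lra.
have p1 : 0 < #|P|%:R :> R by rewrite ltr0n lt0n.
have := entropy_integrand_ge0 (divr_ge0 S0 (ltW p1)) c0.
move/(ler_wpM2l (ltW p1)); rewrite mulr0 !mulrDr !mulrN !mulrA.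
rewrite [_ * S]mulrC mulfK ?gt_eqF // -[c *+ _]mulr_natl; lra.
Qed.

Lemma entropy_attained I (P : pred I) (q : I -> R) :
  (0 < #|P|)%N ->
  let c := (\sum_(i | P i) q i) / #|P|%:R in
  entropy P q = \sum_(i | P i) (q i * ln (q i) - q i * ln c - q i + c).
Proof.
move=> p0; have p1 : 0 < #|P|%:R :> R by rewrite ltr0n.
rewrite /entropy !big_split /= !sumrN -mulr_suml sumr_const.
set S := \sum_(i | P i) q i; rewrite -[_ / _ *+ _]mulr_natr mulfVK ?gt_eqF //; lra.
Qed.

Lemma entropy_ge0 I (P : pred I) (q : I -> R) :
  (forall i, 0 <= q i) -> 0 <= entropy P q.
Proof.
move=> q0; set S := \sum_(i | P i) q i.
have S0 : 0 <= S by apply: sumr_ge0.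
have [S00|Sn0] := eqVneq S 0.
  rewrite /entropy -/S S00 mul0r subr0 big1 // => i Pi.
  have /eqP := S00; rewrite psumr_eq0 // => /allP /(_ i).
  by rewrite mem_index_enum Pi => /(_ isT) /eqP ->; rewrite mul0r.
have Spos : 0 < S by rewrite lt_neqAle eq_sym Sn0.
have p0 : (0 < #|P|)%N.
  rewrite lt0n; apply: contraNneq Sn0 => p0.
  by rewrite /S big_pred0 // => i; exact: card0_eq p0 i.
rewrite entropy_attained //; apply: sumr_ge0 => i _.
by apply: entropy_integrand_ge0 => //; rewrite divr_gt0 // ltr0n.
Qed.

(* For [x <= 4 * m] use [ln (x / m) <= x / m - 1], otherwise [x / m <= n.+1]. *)
Lemma entropy_integrand_le_sqr n x m : 0 < m -> 0 <= x <= n.+1%:R * m ->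
  x ^+ 2 * ln (x ^+ 2) - x ^+ 2 * ln (m ^+ 2) - x ^+ 2 + m ^+ 2 <=
  (9 + 4 * ln n.+1%:R) * (x - m) ^+ 2.
Proof.
move=> m0 /andP[]; have ln0 : 0 <= ln n.+1%:R :> R by rewrite ln_ge0 // ler1n.
rewrite le_eqVlt => /predU1P[<- _|x0 xn].
  rewrite expr0n /= !mul0r !subr0 add0r sub0r sqrrN mulrDl -mulrA.
  have := mulr_ge0 ln0 (sqr_ge0 m); have := sqr_ge0 m; lra.
rewrite !lnXn //.
have -> : x ^+ 2 * (ln x *+ 2) - x ^+ 2 * (ln m *+ 2) - x ^+ 2 + m ^+ 2 =
   2 * x ^+ 2 * ln (x / m) - x ^+ 2 + m ^+ 2 by rewrite ln_div //; ring.
have x20 : 0 <= 2 * x ^+ 2 by rewrite mulr_ge0 // sqr_ge0.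
have lnd : 0 <= ln n.+1%:R * (x - m) ^+ 2 by rewrite mulr_ge0 // sqr_ge0.
have [xm|mx] := leP x (4 * m).
  have xm4 : x / m <= 4 by rewrite ler_pdivrMr.
  have H := ler_wpM2l x20 (ln_le_sub1 (divr_gt0 x0 m0)).
  have E : 2 * x ^+ 2 * (x / m - 1) - x ^+ 2 + m ^+ 2 =
    (2 * (x / m) + 1) * (x - m) ^+ 2 by field; rewrite gt_eqF.
  have : (2 * (x / m) + 1) * (x - m) ^+ 2 <= 9 * (x - m) ^+ 2.
    by apply: ler_wpM2r; [exact: sqr_ge0|lra].
  by rewrite mulrDl -mulrA; lra.
have lnxm : ln (x / m) <= ln n.+1%:R.
  by rewrite ler_ln ?posrE ?divr_gt0 ?ltr0n // ler_pdivrMr.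
have H := ler_wpM2l x20 lnxm.
have K : 2 * x ^+ 2 <= 4 * (x - m) ^+ 2.
  have : 0 <= (x - 4 * m) * x by apply: mulr_ge0; lra.
  by have := sqr_ge0 m; nra.
have := ler_wpM2r ln0 K.
have : 0 <= (x - m) ^+ 2 by exact: sqr_ge0.
have : m ^+ 2 <= x ^+ 2 by rewrite ler_sqr ?nnegrE; lra.
lra.
Qed.

(** [entropy_le] is used at [m ^+ 2], with [m] the mean of [g], rather than at the mean of the
    squares. Nonnegativity gives [g a <= S = n.+1 * m], the range that the pointwise bound asks
    for. *)
Lemma complete_graph_log_sobolev n (g : 'I_n.+1 -> R) : (forall a, 0 <= g a) ->
  entropy predT (fun a => g a ^+ 2) <=
  (9 + 4 * ln n.+1%:R) / (2 * n.+1%:R) * \sum_a \sum_b (g a - g b) ^+ 2.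
Proof.
move=> g0; set S := \sum_a g a.
have n0 : 0 < n.+1%:R :> R by rewrite ltr0n.
have S0 : 0 <= S by apply: sumr_ge0.
have ln0 : 0 <= ln n.+1%:R :> R by rewrite ln_ge0 // ler1n.
have [S00|Sn0] := eqVneq S 0.
  have gz a : g a = 0.
    have /eqP := S00; rewrite psumr_eq0 // => /allP /(_ a).
    by rewrite mem_index_enum => /(_ isT) /eqP.
  rewrite /entropy big1 => [|a _]; last by rewrite gz expr0n /= mul0r.
  rewrite big1 => [|a _]; last by rewrite gz expr0n.
  rewrite mul0r subr0 big1 ?mulr0 // => a _.
  by rewrite big1 // => b _; rewrite !gz subrr expr0n.
pose m := S / n.+1%:R.
have m0 : 0 < m by rewrite divr_gt0 // lt_neqAle eq_sym Sn0.
apply: le_trans (entropy_le _ (fun a => sqr_ge0 (g a)) (exprn_gt0 2 m0)) _.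
apply: (@le_trans _ _ (\sum_a (9 + 4 * ln n.+1%:R) * (g a - m) ^+ 2)).
  apply: ler_sum => a _; apply: entropy_integrand_le_sqr => //.
  rewrite g0 /= /m mulrC divfK ?gt_eqF // /S (bigD1 a) //= lerDl.
  by apply: sumr_ge0.
rewrite -mulr_sumr sum_pair_sqr_diff card_ord -/S.
under eq_bigr do rewrite sqrrB.
rewrite !big_split /= sumrN sumr_const card_ord sumrMnl -mulr_suml -/S.
rewrite le_eqVlt; apply/orP; left; apply/eqP; rewrite /m.
by field; rewrite gt_eqF.
Qed.

End RealSums.

(** * Transposition energy *)

Section TranspositionEnergy.
Context {R : realType}.

(** Products act from left to right, so [tperm a b * s] swaps the values of [s] at positions [a] and
    [b]. Each edge inside [D] is counted four times: two orders of [(a, b)], two endpoints. *)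
Definition energy n (D : pred 'S_n) (f : 'S_n -> R) : R :=
  \sum_(s | D s) \sum_a \sum_(b | D (tperm a b * s)%g)
    (f s - f (tperm a b * s)%g) ^+ 2.

Lemma energy_ge0 n (D : pred 'S_n) (f : 'S_n -> R) : 0 <= energy D f.
Proof. by do 3!apply: sumr_ge0 => ? _; apply: sqr_ge0. Qed.

Lemma lift_perm_inj n (i a : 'I_n.+1) : injective (lift_perm i a).
Proof.
move=> s t st; apply/permP => j; apply: (@lift_inj _ a).
by rewrite -!(lift_perm_lift i) st.
Qed.

Lemma lift_perm_surj n (i a : 'I_n.+1) (s : 'S_n.+1) :
  s i = a -> exists t, lift_perm i a t = s.
Proof.
(* The default [j] is never reached: [s (lift i j)] differs from [s i = a]. *)
move=> sia; pose p j := odflt j (unlift a (s (lift i j))).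
have lp j : lift a (p j) = s (lift i j).
  rewrite /p; case: unliftP => [k -> //|/eqP].
  by rewrite -sia (inj_eq perm_inj) eq_sym (negPf (neq_lift _ _)).
have p_inj : injective p.
  by move=> j k /(congr1 (lift a)); rewrite !lp => /perm_inj/lift_inj.
exists (perm p_inj); apply/permP => k; case: (unliftP i k) => [j|] ->.
  by rewrite lift_perm_lift permE lp.
by rewrite lift_perm_id sia.
Qed.

Lemma sum_lift_perm n (i a : 'I_n.+1) (g : 'S_n.+1 -> R) :
  \sum_(s : 'S_n) g (lift_perm i a s) = \sum_(s : 'S_n.+1 | s i == a) g s.
Proof.
pose h (s : 'S_n.+1) : 'S_n := odflt 1%g [pick t | lift_perm i a t == s].
rewrite (reindex_onto (lift_perm i a) h) => [|s /eqP /lift_perm_surj [t ts]].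
  apply: eq_bigl => t; rewrite lift_perm_id eqxx /h; case: pickP => [u /=|].
    by rewrite (inj_eq (@lift_perm_inj _ _ _)).
  by move/(_ t); rewrite eqxx.
by rewrite /h; case: pickP => [u /eqP //|/(_ t)]; rewrite ts eqxx.
Qed.

Lemma sum_perm_fibers n (i : 'I_n.+1) (g : 'S_n.+1 -> R) :
  \sum_s g s = \sum_a \sum_(s : 'S_n) g (lift_perm i a s).
Proof.
rewrite (partition_big (fun s : 'S_n.+1 => s i) predT) //=.
by apply: eq_bigr => a _; rewrite sum_lift_perm.
Qed.

Lemma lift_perm_tperm n (i a : 'I_n.+1) (c d : 'I_n) (s : 'S_n) :
  lift_perm i a (tperm c d * s) =
  (tperm (lift i c) (lift i d) * lift_perm i a s)%g.
Proof.
rewrite -(lift_permM _ i); congr (_ * _)%g; apply/permP => k.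
case: (unliftP i k) => [j|] ->.
  by rewrite lift_perm_lift inj_tperm //; apply: lift_inj.
by rewrite lift_perm_id tpermD // eq_sym neq_lift.
Qed.

Lemma sum_lift n (i : 'I_n.+1) (g : 'I_n.+1 -> R) :
  \sum_(c < n) g (lift i c) = \sum_(a | a != i) g a.
Proof.
transitivity (\sum_(c : 'I_n | lift i c != i) g (lift i c)).
  by apply: eq_bigl => c; rewrite eq_sym neq_lift.
rewrite [RHS](reindex_omap (lift i) (unlift i)) => [|a]; last first.
  by rewrite eq_sym => /unlift_some[j ? ->]; congr Some.
by apply: eq_bigl => c; rewrite liftK eqxx andbT.
Qed.

(** For [a != b], the swap keeps the value at [i] exactly when [i] is neither [a] nor [b], which
    leaves [n - 1] of the [n + 1] indices. Terms with [a = b] vanish. *)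
Lemma sum_energy_lift_perm n (f : 'S_n.+1 -> R) :
  \sum_i \sum_a energy predT (fun s => f (lift_perm i a s)) =
  (n%:R - 1) * energy predT f.
Proof.
pose E s a b := (f s - f (tperm a b * s)%g) ^+ 2.
transitivity (\sum_s \sum_a \sum_b \sum_(i | (a != i) && (b != i)) E s a b).
  transitivity (\sum_i \sum_s \sum_(a | a != i) \sum_(b | b != i) E s a b).
    apply: eq_bigr => i _; rewrite (sum_perm_fibers i).
    apply: eq_bigr => a _; apply: eq_bigr => s _; rewrite -sum_lift.
    apply: eq_bigr => c _; rewrite -sum_lift; apply: eq_bigr => d _.
    by rewrite lift_perm_tperm.
  rewrite exchange_big; apply: eq_bigr => s _ /=.
  rewrite (exchange_big_dep predT) //=; apply: eq_bigr => a _.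
  by rewrite (exchange_big_dep predT).
rewrite /energy mulr_sumr; apply: eq_bigr => s _.
rewrite mulr_sumr; apply: eq_bigr => a _; rewrite mulr_sumr.
apply: eq_bigr => b _; rewrite -/(E s a b) sumr_const.
have [->|ab] := eqVneq a b.
  by rewrite /E tperm1 mul1g subrr expr0n mul0rn mulr0.
rewrite -[E s a b *+ _]mulr_natl; congr (_ * _).
have := cardC [set a; b]; rewrite cards2 ab card_ord.
rewrite (@eq_card _ [predC [set a; b]] [pred i | (a != i) && (b != i)]).
  set k := #|_| => -[/(congr1 (fun m => m%:R : R))] <-.
  by rewrite -natr1 addrK.
by move=> i; rewrite !inE negb_or ![i == _]eq_sym.
Qed.

(** Swapping the values [s i] and [b] is swapping the positions [i] and [s^-1 b], and the latter
    runs over all positions with [b]. *)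
Lemma sum_value_swaps n (f : 'S_n.+1 -> R) :
  \sum_i \sum_s \sum_b (f s - f (s * tperm (s i) b)%g) ^+ 2 = energy predT f.
Proof.
rewrite /energy exchange_big; apply: eq_bigr => s _; apply: eq_bigr => i _ /=.
rewrite (reindex_inj (@perm_inj _ s)); apply: eq_bigr => j _.
by rewrite -tpermJ -conjgC.
Qed.

Lemma sum_swap_fiber n (i a b : 'I_n) (g : 'S_n -> R) :
  \sum_(s : 'S_n | s i == a) g (s * tperm a b)%g = \sum_(s : 'S_n | s i == b) g s.
Proof.
rewrite [RHS](reindex_inj (mulIg (tperm a b))); apply: eq_bigl => s.
by rewrite permM -{2}(tpermL a b) (inj_eq perm_inj).
Qed.

(** Averaging the step over all positions [i] closes the induction, because
    [(N - 1) / (2N) + 1 / (2(N + 1)) <= 1 / 2] with [N = m + 1]. [L] is fixed throughout, and the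
    bound [m <= n] lets it depend on [n]. *)
Lemma transposition_induction (Phi : forall n, ('S_n -> R) -> R) (L : R) n :
    0 <= L -> (forall f, Phi 1 f <= 0) ->
    (forall m (f : 'S_m.+1 -> R) i, (0 < m <= n)%N ->
      Phi _ f <= \sum_a Phi m (fun s => f (lift_perm i a s)) +
        L / (2 * m.+1%:R) *
        \sum_s \sum_b (f s - f (s * tperm (s i) b)%g) ^+ 2) ->
  forall f : 'S_n.+1 -> R, Phi _ f <= L / (2 * n.+1%:R) * energy predT f.
Proof.
move=> L0 Phi1 step.
suff bound m : (m <= n)%N -> forall f : 'S_m.+1 -> R,
  Phi _ f <= L / (2 * m.+1%:R) * energy predT f by exact: bound.
elim: m => [|m IHm] lt_mn f.
  by apply: le_trans (Phi1 f) _; rewrite mulr_ge0 ?energy_ge0 // divr_ge0.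
have m0 : 0 < m.+1%:R :> R by rewrite ltr0n.
have m1 : 0 < m.+2%:R :> R by rewrite ltr0n.
rewrite -(ler_pM2l m1).
apply: (@le_trans _ _ (\sum_(i < m.+2)
   (L / (2 * m.+1%:R) * \sum_a energy predT (fun s => f (lift_perm i a s)) +
    L / (2 * m.+2%:R) * \sum_s \sum_b (f s - f (s * tperm (s i) b)%g) ^+ 2))).
  have -> : m.+2%:R * Phi _ f = \sum_(i < m.+2) Phi _ f.
    by rewrite sumr_const card_ord mulr_natl.
  apply: ler_sum => i _; apply: le_trans (step _ f i _) _ => //.
  by rewrite lerD2r mulr_sumr; apply: ler_sum => a _; apply/IHm/ltnW.
rewrite big_split -!mulr_sumr sum_energy_lift_perm sum_value_swaps /=.
have := mulr_ge0 L0 (energy_ge0 predT f); set T := energy _ _ => LT.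
set N : R := m.+1%:R in m0 *.
have -> : L / (2 * N) * ((N - 1) * T) + L / (2 * m.+2%:R) * T =
   L * T * ((N - 1) / (2 * N) + 1 / (2 * m.+2%:R)).
  by field; rewrite !gt_eqF.
have -> : m.+2%:R * (L / (2 * m.+2%:R) * T) = L * T / 2.
  by field; rewrite gt_eqF.
apply: ler_wpM2l => //.
have -> : m.+2%:R = N + 1 by rewrite /N natr1.
have -> : (N - 1) / (2 * N) + 1 / (2 * (N + 1)) = 2^-1 - (2 * N * (N + 1))^-1.
  by field; rewrite !gt_eqF // ltr_wpDl // ltW.
by rewrite lerBlDr lerDl invr_ge0 mulr_ge0 ?addr_ge0 ?mulr_ge0 // ltW.
Qed.

End TranspositionEnergy.

(** * The symmetric group *)

Section SymmetricGroup.
Context {R : realType}.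

Lemma card_predT_perm n : #|(predT : pred 'S_n)| = n`!.
Proof.
rewrite -card_Sn; exact: eq_card.
Qed.

Lemma card_fiber n (i a : 'I_n.+1) : #|[pred s : 'S_n.+1 | s i == a]| = n`!.
Proof.
apply/eqP; rewrite -(eqr_nat R) -sum1_card natr_sum.
by rewrite -(sum_lift_perm i a (fun=> 1%:R)) sumr_const card_predT_perm.
Qed.

Lemma sum_value_swaps_fibers n (i : 'I_n.+1) (f : 'S_n.+1 -> R) :
  \sum_s \sum_b (f s - f (s * tperm (s i) b)%g) ^+ 2 =
  \sum_a \sum_b \sum_(s : 'S_n.+1 | s i == a) (f s - f (s * tperm a b)%g) ^+ 2.
Proof.
rewrite (partition_big (fun s : 'S_n.+1 => s i) predT) //=.
apply: eq_bigr => a _; rewrite [RHS]exchange_big.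
by apply: eq_bigr => s /eqP <-.
Qed.

(** Right multiplication by [tperm a b] matches the two fibres; Cauchy-Schwarz then costs the fibre
    size. *)
Lemma sum_diff_fibers_le n (i a b : 'I_n.+1) (f : 'S_n.+1 -> R) :
  (\sum_(s : 'S_n) f (lift_perm i a s) - \sum_(s : 'S_n) f (lift_perm i b s))
    ^+ 2 <=
  n`!%:R * \sum_(s : 'S_n.+1 | s i == a) (f s - f (s * tperm a b)%g) ^+ 2.
Proof.
rewrite !sum_lift_perm -(sum_swap_fiber _ a b) -sumrB -(card_fiber i a).
exact: sqr_sum_le.
Qed.

Lemma symmetric_group_poincare n (f : 'S_n.+1 -> R) :
  \sum_s f s ^+ 2 - (\sum_s f s) ^+ 2 / (n.+1)`!%:R <=
  (2 * n.+1%:R)^-1 * energy predT f.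
Proof.
rewrite -[(2 * _)^-1]mul1r.
pose Phi m (h : 'S_m -> R) := \sum_s h s ^+ 2 - (\sum_s h s) ^+ 2 / m`!%:R.
apply: (@transposition_induction R Phi) => //= [h|m h i _].
  suff sum1 (g : 'S_1 -> R) : \sum_s g s = g 1%g.
    by rewrite /Phi !sum1 divr1 subrr.
  rewrite (bigD1 1%g) //= big1 ?addr0 // => s /eqP[].
  by apply/permP => j; rewrite !ord1.
have fact0 : 0 < m`!%:R :> R by rewrite ltr0n fact_gt0.
have m0 : 0 < m.+1%:R :> R by rewrite ltr0n.
rewrite {}/Phi sum_value_swaps_fibers !(sum_perm_fibers i).
rewrite big_split /= -addrA lerD2l sumrN.
set S := fun a => \sum_(s : 'S_m) h (lift_perm i a s).
(* With the sums of squares cancelled, the variance between fibre sums remains; on the complete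
   graph the inequality for it is the identity [sum_pair_sqr_diff]. *)
apply: (@le_trans _ _ (- (\sum_a S a ^+ 2) / m`!%:R +
  1 / (2 * m.+1%:R) * ((\sum_a \sum_b (S a - S b) ^+ 2) / m`!%:R))).
  rewrite sum_pair_sqr_diff card_ord factS natrM.
  rewrite le_eqVlt; apply/orP; left; apply/eqP.
  by rewrite -/S; field; rewrite !gt_eqF.
rewrite mulNr mulr_suml lerD2l ler_wpM2l ?divr_ge0 ?mulr_ge0 //.
rewrite mulr_suml; apply: ler_sum => a _.
rewrite mulr_suml; apply: ler_sum => b _.
by rewrite ler_pdivrMr // mulrC; apply: sum_diff_fibers_le.
Qed.

(** Reverse triangle inequality for the L2 norms on two fibres matched by [tperm a b]. *)
Lemma sqrt_mean_diff_fibers_le n (i a b : 'I_n.+1) (f : 'S_n.+1 -> R) :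
  (Num.sqrt ((\sum_(s : 'S_n) f (lift_perm i a s) ^+ 2) / n`!%:R) -
   Num.sqrt ((\sum_(s : 'S_n) f (lift_perm i b s) ^+ 2) / n`!%:R)) ^+ 2 *
    n`!%:R <=
  \sum_(s : 'S_n.+1 | s i == a) (f s - f (s * tperm a b)%g) ^+ 2.
Proof.
have fact0 : 0 < n`!%:R :> R by rewrite ltr0n fact_gt0.
rewrite (sum_lift_perm i a (fun s => f s ^+ 2)).
rewrite (sum_lift_perm i b (fun s => f s ^+ 2)) -(sum_swap_fiber _ a b).
set A := \sum_(_ | _) _; set B := \sum_(_ | _) _.
have A0 : 0 <= A by apply: sumr_ge0 => s _; apply: sqr_ge0.
have B0 : 0 <= B by apply: sumr_ge0 => s _; apply: sqr_ge0.
under eq_bigr do rewrite sqrrB; rewrite !big_split /= sumrN sumrMnl -/A -/B.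
rewrite !sqrtrM // sqrtrV; last exact: ltW.
set r := Num.sqrt n`!%:R; have r0 : 0 < r by rewrite sqrtr_gt0.
have -> : n`!%:R = r ^+ 2 by rewrite sqr_sqrtr // ltW.
have -> : (Num.sqrt A / r - Num.sqrt B / r) ^+ 2 * r ^+ 2 =
   (Num.sqrt A - Num.sqrt B) ^+ 2 by field; rewrite gt_eqF.
rewrite sqrrB !sqr_sqrtr // lerD2r lerD2l lerN2 ler_wMn2r // -sqrtrM //.
set C := \sum_(_ | _) _; apply: le_trans (ler_norm C) _.
by rewrite -sqrtr_sqr ler_sqrt ?mulr_ge0 // cauchy_schwarz_sum.
Qed.

Lemma symmetric_group_log_sobolev n (f : 'S_n.+1 -> R) :
  entropy predT (fun s => f s ^+ 2) <=
  (9 + 4 * ln n.+1%:R) / (2 * n.+1%:R) * energy predT f.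
Proof.
have ln0 m : 0 <= ln m.+1%:R :> R by rewrite ln_ge0 // ler1n.
pose Phi m (h : 'S_m -> R) := entropy predT (fun s => h s ^+ 2).
apply: (@transposition_induction R Phi) => //= [|h|m h i mn].
- by rewrite addr_ge0 // mulr_ge0.
- suff sum1 (g : 'S_1 -> R) : \sum_s g s = g 1%g.
    by rewrite /Phi /entropy !sum1 card_predT_perm divr1 subrr.
  rewrite (bigD1 1%g) //= big1 ?addr0 // => s /eqP[].
  by apply/permP => j; rewrite !ord1.
have fact0 : 0 < m`!%:R :> R by rewrite ltr0n fact_gt0.
have m0 : 0 < m.+1%:R :> R by rewrite ltr0n.
(* The complete graph on [m.+1] points has its own constant, dominated by the fixed [L]. *)
have nm : 9 + 4 * ln m.+1%:R <= 9 + 4 * ln n.+1%:R :> R.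
  by rewrite lerD2l ler_pM2l // ler_ln ?posrE ?ltr0n // ler_nat ltnS; case/andP: mn.
rewrite {}/Phi sum_value_swaps_fibers /entropy !card_predT_perm.
rewrite !(sum_perm_fibers i) big_split /= -addrA lerD2l sumrN.
pose S a := \sum_(s : 'S_m) h (lift_perm i a s) ^+ 2.
have S0 a : 0 <= S a / m`!%:R.
  by apply: divr_ge0 => //; apply: sumr_ge0 => s _; apply: sqr_ge0.
pose g a := Num.sqrt (S a / m`!%:R).
have g0 a : 0 <= g a by apply: sqrtr_ge0.
have gE : (fun a => g a ^+ 2) = (fun a => S a / m`!%:R).
  by apply/funext => a; rewrite sqr_sqrtr.
rewrite -lerBlDl opprK addrC.
(* Chain rule: once the entropies inside the fibres are removed, [m!] times the entropy of the fibre
   means of [h ^+ 2] is left. Their square root [g] goes into the complete graph inequality. *)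
apply: (@le_trans _ _ (entropy predT (fun a => S a / m`!%:R) * m`!%:R)).
  rewrite /entropy card_ord mulrBl !mulr_suml factS natrM.
  rewrite lerB //.
    apply: ler_sum => a _; rewrite -/(S a).
    by rewrite mulrAC mulfVK ?gt_eqF.
  apply: ler_sum => a _; rewrite -/(S a).
  rewrite mulrAC mulfVK ?gt_eqF //; set x := ln _; set y := ln _.
  suff -> : x = y by [].
  congr ln; apply: eq_bigr => b _; rewrite -/(S b).
  by field; rewrite !gt_eqF.
rewrite -gE; apply: le_trans (ler_wpM2r (ltW fact0) (complete_graph_log_sobolev g0)) _.
rewrite -[X in X <= _]mulrA; apply: ler_pM => //.
- by rewrite divr_ge0 ?mulr_ge0 // addr_ge0 // mulr_ge0.
- apply: mulr_ge0 => //; do 2!apply: sumr_ge0 => ? _; apply: sqr_ge0.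
- by rewrite ler_pM2r // invr_gt0 mulr_gt0.
rewrite mulr_suml; apply: ler_sum => a _.
rewrite mulr_suml; apply: ler_sum => b _.
exact: sqrt_mean_diff_fibers_le.
Qed.

End SymmetricGroup.

(** * Releasing one fixed-point constraint *)

Section Extension.
Context {R : realType}.

Definition avoids n (A : seq 'I_n) : pred 'S_n :=
  fun s => all (fun i => s i != i) A.

Lemma exists_notin_seq n (r : seq 'I_n) : (size r < n)%N -> exists i, i \notin r.
Proof.
move=> rn; apply/existsP; apply: contraTT rn => /existsPn r_all; rewrite -leqNgt.
apply: leq_trans (card_size r); rewrite -[X in (X <= _)%N](card_ord n).
by rewrite (@eq_card _ (mem r) 'I_n) // => i; rewrite -[_ \in mem r]negbK r_all.
Qed.

Lemma sqr_sub_le (x y z : R) :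
  (x - z) ^+ 2 <= 2 * (x - y) ^+ 2 + 2 * (y - z) ^+ 2.
Proof. by have := sqr_ge0 (x - 2 * y + z); nra. Qed.

Lemma sqr_dist_mean_le (I : finType) (P : pred I) (x : R) (y : I -> R) :
  (0 < #|P|)%N ->
  (x - (\sum_(i | P i) y i) / #|P|%:R) ^+ 2 <=
  (\sum_(i | P i) (x - y i) ^+ 2) / #|P|%:R.
Proof.
move=> P0; have P1 : 0 < #|P|%:R :> R by rewrite ltr0n.
have -> : x - (\sum_(i | P i) y i) / #|P|%:R =
   (\sum_(i | P i) (x - y i)) / #|P|%:R.
  by rewrite sumrB sumr_const -mulr_natr; field; rewrite gt_eqF.
rewrite expr_div_n ler_pdivrMr ?exprn_gt0 // [_%:R ^+ 2]expr2 mulrA.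
by rewrite mulfVK ?gt_eqF // mulrC sqr_sum_le.
Qed.

Section Step.
Variables (n : nat) (k : 'I_n) (A : seq 'I_n) (f : 'S_n -> R).
Hypothesis n_gt3 : (3 < n)%N.

Let D := avoids A.
Let D' := avoids (k :: A).
Let sw (j : 'I_n) (s : 'S_n) := (tperm k j * s)%g.
Let N : R := n.-1%:R.

Let G (s : 'S_n) (a b : 'I_n) : R :=
  if D' s && D' (tperm a b * s)%g then (f s - f (tperm a b * s)%g) ^+ 2 else 0.
Let H s := \sum_a \sum_b G s a b.

Let N_gt0 : 0 < N.
Proof. by rewrite ltr0n -subn1 subn_gt0 (leq_trans _ n_gt3). Qed.

Let card_neq : #|[pred j | j != k]| = n.-1.
Proof. by have := cardC1 k; rewrite card_ord. Qed.

Let G_ge0 s a b : 0 <= G s a b.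
Proof. by rewrite /G; case: ifP => // _; apply: sqr_ge0. Qed.

Let H_ge0 s : 0 <= H s.
Proof. by do 2!apply: sumr_ge0 => ? _. Qed.

Let energyE : energy D' f = \sum_(s | D' s) H s.
Proof.
apply: eq_bigr => s Ds; apply: eq_bigr => a _; rewrite big_mkcond /=.
by apply: eq_bigr => b _; rewrite /G Ds.
Qed.

Let sumG_le s a : \sum_b G s a b <= H s.
Proof. by rewrite /H [leRHS](bigD1 a) //= lerDl; do 2!apply: sumr_ge0 => ? _. Qed.

(** [sw j s] sends [k] to [s j], which differs from [s k = k], and [j] to [k]. So all [N]
    permutations averaged by [fill] lie in [D']. *)
Let sw_avoids s j : D s -> s k = k -> j != k -> D' (sw j s).
Proof.
move=> Ds sk jk; apply/andP; split.
  by rewrite permM tpermL -[X in _ != X]sk (inj_eq perm_inj).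
apply/allP => i iA; rewrite permM.
case: tpermP => [-> | -> | _ _]; last exact: (allP Ds).
  by rewrite -[X in _ != X]sk (inj_eq perm_inj).
by rewrite sk eq_sym.
Qed.

(** The pair [(s, j)] is recovered from [u = sw j s] through [j = u^-1 k], so each [u] is counted at
    most once. *)
Let sum_sw_le (g : 'S_n -> R) : (forall s, 0 <= g s) ->
  \sum_(s | D s && (s k == k)) \sum_(j | j != k) g (sw j s) <=
  \sum_(s | D' s) g s.
Proof.
move=> g0; rewrite exchange_big /=.
under eq_bigr => j jk do rewrite (reindex_inj (mulgI (tperm k j))) /=.
rewrite (exchange_big_dep predT) //= [leRHS]big_mkcond /=.
apply: ler_sum => s _.
have swK j : sw j (tperm k j * s) = s by rewrite /sw mulgA tperm2 mul1g.
under eq_bigr do rewrite swK.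
case: ifPn => [D's|nD's]; last first.
  rewrite big_pred0 // => j; apply/negP => /andP[jk /andP[Ds /eqP sk]].
  by move/negP: nD's; apply; rewrite -(swK j); apply: sw_avoids.
rewrite sumr_const -[g s *+ _]mulr_natr ler_piMr // (ler_nat _ _ 1).
rewrite -[X in (_ <= X)%N](card1 (s^-1 k)%g).
apply/subset_leq_card/fintype.subsetP => j /and3P[_ _]; rewrite permM tpermL inE => /eqP <-.
by rewrite permK.
Qed.

(** Cost of both two-step paths from [sw j s] to [sw l s], so that the bound is symmetric in [j] and
    [l]. *)
Let S s j l : R :=
  2 * (G (sw j s) j l + G (sw l s) k j + G (sw l s) l j + G (sw j s) k l).

Let S_ge0 s j l : 0 <= S s j l.
Proof. by rewrite mulr_ge0 // !addr_ge0. Qed.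

Let S_sym s j l : S s j l = S s l j.
Proof. by rewrite /S; congr (_ * _); ring. Qed.

(** Since [(k l) = (k j)(j l)(k j)], the two ends share the neighbour [mid], which sends [k] to
    [s j], [j] to [s l] and [l] to [k]. Only [s l != j] has to be assumed for [mid] to lie in
    [D']. *)
Let two_swaps s j l : D s -> s k = k -> j != k -> l != k -> j != l ->
  s l != j ->
  (f (sw j s) - f (sw l s)) ^+ 2 <=
  2 * (G (sw j s) j l + G (sw l s) k j).
Proof.
move=> Ds sk jk lk jl slj; set mid := (tperm j l * sw j s)%g.
have midE : mid = (tperm k j * sw l s)%g.
  have E : (tperm k l)%g = (tperm k j * tperm j l * tperm k j)%g.
    have tkjl : tperm k j l = l by rewrite tpermD // eq_sym.
    have := tpermJ j l (tperm k j); rewrite tpermR tkjl conjgE.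
    by rewrite tpermV mulgA => ->.
  by rewrite /mid /sw [tperm k l]E !mulgA tperm2 mul1g.
have Dm : D' mid.
  have tjlk : tperm j l k = k by rewrite tpermD.
  rewrite /D' /avoids /= {1}/mid /sw !permM tjlk tpermL.
  rewrite -[X in _ != X]sk (inj_eq perm_inj) jk /=; apply/allP => i iA.
  rewrite /mid /sw !permM; case: (tpermP j l i) => [->|->|/eqP ij /eqP il].
  - by rewrite tpermD // eq_sym.
  - by rewrite tpermR sk eq_sym.
  case: tpermP => [->|ji|_ _]; last exact: (allP Ds).
    by rewrite -[X in _ != X]sk (inj_eq perm_inj).
  by rewrite ji eqxx in ij.
have Dj := sw_avoids Ds sk jk; have Dl := sw_avoids Ds sk lk.
apply: le_trans (sqr_sub_le _ (f mid) _) _.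
rewrite mulrDr /G -/mid -midE Dm Dj Dl /= lerD2l.
by rewrite -[X in 2 * X <= _]sqrrN opprB.
Qed.

Let good_le s j l : D s -> s k = k -> j != k -> l != k ->
  (s l != j) || (s j != l) -> (f (sw j s) - f (sw l s)) ^+ 2 <= S s j l.
Proof.
move=> Ds sk jk lk; have [->|jl] := eqVneq j l.
  by rewrite subrr expr0n S_ge0.
case/orP => [slj|sjl].
  apply: le_trans (two_swaps Ds sk jk lk jl slj) _.
  by rewrite ler_pM2l // -[leRHS]addrA lerDl addr_ge0.
rewrite -sqrrN opprB S_sym.
apply: le_trans (two_swaps Ds sk lk jk _ sjl) _; first by rewrite eq_sym.
by rewrite ler_pM2l // -[leRHS]addrA lerDl addr_ge0.
Qed.

Let T s j := \sum_(i | i != k) S s j i.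

Let S_le_T s j i : i != k -> S s j i <= T s j.
Proof. by move=> ik; rewrite /T (bigD1 i) //= lerDl sumr_ge0. Qed.

(* If [s] exchanges [j] and [l] then no path of two transpositions joins
   [sw j s] to [sw l s] inside [D']; the detour goes through [sw i s]. *)
Let pair_le s j l : D s -> s k = k -> j != k -> l != k ->
  (f (sw j s) - f (sw l s)) ^+ 2 <=
  S s j l + (if l == s j then 2 * (T s j + T s l) else 0).
Proof.
move=> Ds sk jk lk.
have T0 m : 0 <= T s m by apply: sumr_ge0.
have [good|] := boolP ((s l != j) || (s j != l)).
  apply: le_trans (good_le Ds sk jk lk good) _.
  by rewrite lerDl; case: ifP => // _; rewrite mulr_ge0 // addr_ge0.
rewrite negb_or !negbK => /andP[/eqP slj /eqP sjl].
(* A fourth index exists because [3 < n]. As [s j = l] and [s l = j] both differ from [i], both legs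
   through [i] fall under [good_le]. *)
have [i] := @exists_notin_seq _ [:: j; l; k] n_gt3.
rewrite !inE !negb_or => /and3P[ij il ik].
have := good_le Ds sk jk ik; rewrite sjl [l == i]eq_sym il orbT => /(_ isT) ji.
have := good_le Ds sk ik lk; rewrite slj [j == i]eq_sym ij => /(_ isT) li.
rewrite eqxx ler_wpDl //; apply: le_trans (sqr_sub_le _ (f (sw i s)) _) _.
rewrite mulrDr lerD // ler_pM2l //; first by apply: le_trans ji (S_le_T _ _ ik).
by apply: le_trans li _; rewrite S_sym S_le_T.
Qed.

(** 8 = 2 * 2 * 2: the factor in [S], the symmetrization in [j] and [l], and the two terms of [g],
    each with row sum at most [H]. *)
Let sum_T_le s : \sum_(j | j != k) T s j <= 8 * \sum_(j | j != k) H (sw j s).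
Proof.
pose g j l := G (sw j s) j l + G (sw j s) k l.
have -> : \sum_(j | j != k) T s j =
   2 * (\sum_(j | j != k) \sum_(l | l != k) (g j l + g l j)).
  rewrite mulr_sumr; apply: eq_bigr => j _; rewrite mulr_sumr.
  by apply: eq_bigr => l _; rewrite /S /g; congr (_ * _); ring.
under eq_bigr do rewrite big_split /=.
rewrite big_split /= [X in _ + X]exchange_big /=.
set X := \sum_(_ | _) _; suff : X <= 2 * \sum_(j | j != k) H (sw j s) by lra.
rewrite mulr_sumr; apply: ler_sum => j _.
apply: (@le_trans _ _ (\sum_l g j l)).
  by rewrite [leLHS]big_mkcond; apply: ler_sum => l _; case: ifP => // _; apply: addr_ge0.
by rewrite big_split mulr_natl mulr2n lerD //= sumG_le.
Qed.

(** 40 = 5 * 8. Each [j] pays [T s j], plus [2 * (T s j + T s (s j))] for the single [l = s j]; [s]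
    permutes the indices other than [k], so the total is five sums of [T]. *)
Let sum_pairs_le s : D s -> s k = k ->
  \sum_(j | j != k) \sum_(l | l != k) (f (sw j s) - f (sw l s)) ^+ 2 <=
  40 * \sum_(j | j != k) H (sw j s).
Proof.
move=> Ds sk; suff : \sum_(j | j != k) \sum_(l | l != k)
   (f (sw j s) - f (sw l s)) ^+ 2 <= 5 * \sum_(j | j != k) T s j.
  by have := sum_T_le s; lra.
have sneq j : (s j != k) = (j != k) by rewrite -{1}sk (inj_eq perm_inj).
apply: (@le_trans _ _ (\sum_(j | j != k) (T s j + 2 * (T s j + T s (s j))))).
  apply: ler_sum => j jk.
  apply: (@le_trans _ _ (\sum_(l | l != k) (S s j l +
     (if l == s j then 2 * (T s j + T s l) else 0)))).
    by apply: ler_sum => l lk; apply: pair_le.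
  rewrite big_split lerD2l /= -big_mkcondr.
  rewrite (big_pred1 (s j)) // => l /=.
  by case: (eqVneq l (s j)) => [->|_]; rewrite ?sneq ?jk ?andbF.
rewrite big_split /= -mulr_sumr big_split /=.
suff -> : \sum_(j | j != k) T s (s j) = \sum_(j | j != k) T s j by lra.
rewrite [RHS](reindex_inj (@perm_inj _ s)) /=.
by apply: eq_bigl => j; rewrite sneq.
Qed.

Definition fill (s : 'S_n) : R :=
  if s k == k then (\sum_(j | j != k) f (sw j s)) / N else f s.

(** Jensen's inequality compares the average with each of its members, [sum_pairs_le] bounds the
    pairs, and [sum_sw_le] passes to the energy. *)
Let cross_le :
  \sum_(s | D s && (s k == k)) \sum_(j | j != k) (fill s - f (sw j s)) ^+ 2 <=
  40 / N * energy D' f.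
Proof.
apply: (@le_trans _ _ (\sum_(s | D s && (s k == k))
    40 / N * \sum_(j | j != k) H (sw j s))); last first.
  rewrite -mulr_sumr energyE; apply: ler_wpM2l; last exact: sum_sw_le.
  by rewrite divr_ge0 // ltW.
apply: ler_sum => s /andP[Ds /eqP sk].
rewrite mulrAC ler_pdivlMr // (le_trans _ (sum_pairs_le Ds sk)) //.
rewrite mulr_suml; apply: ler_sum => j jk.
rewrite -ler_pdivlMr // /fill sk eqxx -sqrrN opprB /N -card_neq.
apply: sqr_dist_mean_le; rewrite card_neq -subn1 subn_gt0.
exact: leq_trans n_gt3.
Qed.

(** For [t = tperm a b] fixing [k], [sw (t j) (t * s) = t * sw j s]. The two averages thus match
    term by term along edges of [D'], and Cauchy-Schwarz gains the factor [1 / N]. *)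
Let inner_le : \sum_(s | D s && (s k == k)) \sum_(a | a != k)
    \sum_(b | (b != k) && D (tperm a b * s)%g)
      (fill s - fill (tperm a b * s)%g) ^+ 2 <=
  N^-1 * energy D' f.
Proof.
apply: (@le_trans _ _ (\sum_(s | D s && (s k == k))
    N^-1 * \sum_(j | j != k) H (sw j s))); last first.
  rewrite -mulr_sumr energyE; apply: ler_wpM2l; last exact: sum_sw_le.
  by rewrite invr_ge0 ltW.
apply: ler_sum => s /andP[Ds /eqP sk].
apply: (@le_trans _ _ (\sum_a \sum_b N^-1 * \sum_(j | j != k) G (sw j s) a b));
  last first.
  under eq_bigr do rewrite -mulr_sumr exchange_big /=.
  by rewrite -mulr_sumr exchange_big.
have sumG0 a b : 0 <= N^-1 * \sum_(j | j != k) G (sw j s) a b.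
  by rewrite mulr_ge0 ?invr_ge0 ?sumr_ge0 // ltW.
rewrite [leLHS]big_mkcond; apply: ler_sum => a _.
case: ifP => [ak|_]; last exact: sumr_ge0.
rewrite [leLHS]big_mkcond; apply: ler_sum => b _.
case: ifP => // /andP[bk Dab].
set t := (tperm a b) in Dab *.
have tk : t k = k by rewrite tpermD.
have tneq j : (t j != k) = (j != k) by rewrite -{1}tk (inj_eq perm_inj).
have tsk : (t * s)%g k = k by rewrite permM tk.
have swt j : sw (t j) (t * s)%g = (t * sw j s)%g.
  have tt : (t * t)%g = 1%g by apply: tperm2.
  by rewrite /sw -{1}tk -tpermJ conjgE tpermV -!mulgA (mulgA t t) tt mul1g.
rewrite /fill sk tsk eqxx [X in _ - X / _](reindex_inj (@perm_inj _ t)) /=.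
rewrite (eq_bigl _ _ tneq) -mulrBl -sumrB expr_div_n.
rewrite ler_pdivrMr ?exprn_gt0 // mulrC expr2 mulrA mulfK ?gt_eqF //.
rewrite /N -card_neq; apply: le_trans (sqr_sum_le _ _) _.
apply: ler_wpM2l => //; apply: ler_sum => j jk.
rewrite swt /G -/t (sw_avoids Ds sk jk) -swt sw_avoids //.
by rewrite tneq.
Qed.

(* 161 = 1 + 4 * 40: the pairs of permutations fixing [k] cost [1 / N], and each
   of the four kinds of ordered pairs where one side fixes [k] costs [40 / N]. *)
Lemma energy_fill_le : energy D fill <= (1 + 161 / N) * energy D' f.
Proof.
pose t (s : 'S_n) a b : R := if D s && D (tperm a b * s)%g
  then (fill s - fill (tperm a b * s)%g) ^+ 2 else 0.
pose w (s : 'S_n) a b := if [&& s k == k, a != k & b != k] then t s a b else 0.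
pose u (s : 'S_n) b := if (s k == k) && (b != k) then t s k b else 0.
have t0 s a b : 0 <= t s a b by rewrite /t; case: ifP => // _; apply: sqr_ge0.
have w0 s a b : 0 <= w s a b by rewrite /w; case: ifP.
have u0 s b : 0 <= u s b by rewrite /u; case: ifP.
have tC s a b : t s a b = t s b a by rewrite /t tpermC.
have tS s a b : t (tperm a b * s)%g a b = t s a b.
  rewrite /t mulgA tperm2 mul1g andbC.
  by case: ifP => // _; rewrite -sqrrN opprB.
(* If an end fixes [k] and [a != b], then either [k] is among [a], [b] and exactly one end fixes it
   (a [u] term), or both ends do (a [w] term). *)
have tsplit s a b : t s a b <= G s a b + w s a b
   + ((if a == k then u s b + u (tperm k b * s)%g b else 0)
   + (if b == k then u s a + u (tperm k a * s)%g a else 0)).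
  have v0 c d : 0 <= (if c == k then u s d + u (tperm k d * s)%g d else 0).
    by case: ifP => // _; rewrite addr_ge0.
  have v0a := v0 a b; have v0b := v0 b a.
  have [Gt|s_fix] := boolP ((s k != k) && ((tperm a b * s)%g k != k)).
    suff -> : t s a b = G s a b by rewrite -addrA lerDl !addr_ge0.
    case/andP: Gt => sk tsk.
    by rewrite /t /G /D' /avoids /fill /= sk tsk (negPf sk) (negPf tsk).
  have [ab|ab] := eqVneq a b.
    rewrite {1}/t ab tperm1 mul1g subrr expr0n /=.
    by rewrite if_same -ab !addr_ge0.
  have u_le c : c != k -> ~~ ((s k != k) && ((tperm k c * s)%g k != k)) ->
      t s k c <= u s c + u (tperm k c * s)%g c.
    move=> ck; rewrite negb_and !negbK => /orP[sk|sk].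
      by rewrite {1}/u sk ck lerDl.
    by rewrite [u (_ * _)%g _]/u sk ck tS lerDr.
  have [ak|ak] := eqVneq a k.
    rewrite ak in ab s_fix *; rewrite eq_sym (negPf ab) addr0.
    by rewrite ler_wpDl ?addr_ge0 // u_le // eq_sym.
  have [bk|bk] := eqVneq b k.
    rewrite bk tpermC in s_fix *; rewrite tC add0r.
    by rewrite ler_wpDl ?addr_ge0 // u_le.
  move: s_fix; rewrite permM tpermD // andbb negbK => /eqP sk.
  by rewrite !addr0 /w sk eqxx ak bk /= lerDr.
have sumE : energy D fill = \sum_s \sum_a \sum_b t s a b.
  rewrite /energy big_mkcond; apply: eq_bigr => s _; rewrite /t.
  case: (D s) => /=; last by rewrite big1 // => a _; rewrite big1.
  by apply: eq_bigr => a _; rewrite big_mkcond.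
have sum_u : \sum_s \sum_b u s b <= 40 / N * energy D' f.
  apply: le_trans cross_le; rewrite [leRHS]big_mkcond; apply: ler_sum => s _.
  rewrite /u; case: (s k =P k) => sk /=; last by rewrite andbF big1.
  rewrite andbT; case: ifP => Ds.
    rewrite -big_mkcond; apply: ler_sum => b bk; rewrite /t Ds /=.
    case: ifP => _; last exact: sqr_ge0.
    rewrite {2}/fill permM tpermL -[X in _ == X]sk (inj_eq perm_inj).
    by rewrite (negPf bk).
  by rewrite big1 // => b _; rewrite /t Ds; case: ifP.
have sum_u' : \sum_s \sum_b u (tperm k b * s)%g b = \sum_s \sum_b u s b.
  rewrite exchange_big [RHS]exchange_big; apply: eq_bigr => b _ /=.
  by rewrite [RHS](reindex_inj (mulgI (tperm k b))).
have sum_w : \sum_s \sum_a \sum_b w s a b <= N^-1 * energy D' f.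
  apply: le_trans inner_le; rewrite [leRHS]big_mkcond; apply: ler_sum => s _.
  rewrite /w; case: (s k =P k) => sk /=; last first.
    by rewrite andbF big1 // => a _; rewrite big1.
  rewrite andbT; case: ifP => Ds; last first.
    by rewrite big1 // => a _; rewrite big1 // => b _; rewrite /t Ds; case: ifP.
  rewrite [leRHS]big_mkcond; apply: ler_sum => a _.
  case: (a != k) => /=; last by rewrite big1.
  rewrite [leRHS]big_mkcond; apply: ler_sum => b _.
  by rewrite /t Ds; case: (b != k).
have sum_G : \sum_s \sum_a \sum_b G s a b = energy D' f.
  rewrite energyE [RHS]big_mkcond; apply: eq_bigr => s _.
  case: ifPn => // /negPf Ds; rewrite big1 // => a _.
  by rewrite big1 // => b _; rewrite /G Ds.
rewrite sumE; apply: (@le_trans _ _ (\sum_s (\sum_a \sum_b G s a b +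
   \sum_a \sum_b w s a b + 2 * \sum_b u s b +
   2 * \sum_b u (tperm k b * s)%g b))); last first.
  rewrite !big_split /= -!mulr_sumr sum_u' sum_G.
  have -> : (1 + 161 / N) * energy D' f = energy D' f + N^-1 * energy D' f +
    4 * (40 / N * energy D' f) by ring.
  by move: sum_u sum_w; lra.
apply: ler_sum => s _.
apply: le_trans (ler_sum _ (fun a _ => ler_sum _ (fun b _ => tsplit s a b))) _.
under eq_bigr do rewrite big_split /= big_split /=.
rewrite big_split /= big_split /= -!addrA !lerD2l.
under eq_bigr do rewrite big_split /=.
rewrite big_split /= [X in _ + X]exchange_big /=.
have pick v : \sum_a \sum_b (if a == k then v b else 0) = \sum_b v b :> R.
  rewrite (bigD1 k) //= [X in _ + X]big1 ?addr0 => [|a /negPf ak].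
    by apply: eq_bigr => b _; rewrite eqxx.
  by rewrite big1 // => b _; rewrite ak.
by rewrite !pick big_split /=; lra.
Qed.

End Step.
End Extension.

(** * Derangements *)

Section Derangements.
Context {R : realType}.

Lemma avoids_extension n (A : seq 'I_n) (f : 'S_n -> R) : (3 < n)%N ->
  exists F : 'S_n -> R, (forall s, avoids A s -> F s = f s) /\
    energy predT F <= (1 + 161 / n.-1%:R) ^+ size A * energy (avoids A) f.
Proof.
move=> n3; elim: A f => [|k A IHA] f.
  by exists f; split=> //; rewrite expr0 mul1r.
have [F [Ff F_le]] := IHA (fill k f); exists F; split=> [s /andP[sk As]|].
  by rewrite Ff // /fill (negPf sk).
by apply: le_trans F_le _; rewrite exprSr -mulrA ler_wpM2l ?energy_fill_le //.
Qed.

Lemma derangement_extension n (f : 'S_n -> R) : (3 < n)%N ->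
  exists F : 'S_n -> R, (forall s, is_derangement s -> F s = f s) /\
    energy predT F <= expR 322 * energy (@is_derangement n) f.
Proof.
move=> n3; have [F [Ff F_le]] := avoids_extension (enum 'I_n) f n3.
have E : avoids (enum 'I_n) = @is_derangement n.
  apply/funext => s; apply/allP/forallP => [sA i|sA i _]; last exact: sA.
  by apply: sA; rewrite mem_enum.
rewrite E in Ff F_le; exists F; split => //.
apply: le_trans F_le _; apply: ler_wpM2r; first exact: energy_ge0.
rewrite size_enum_ord; have n1 : 0 < n.-1%:R :> R.
  by rewrite ltr0n -subn1 subn_gt0 (leq_trans _ n3).
(* By [1 + x <= expR x] the factor is at most [expR (161 * n / (n - 1))], and [n <= 2 * (n - 1)]
   gives 322. *)
apply: (@le_trans _ _ (expR (161 / n.-1%:R) ^+ n)).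
  by rewrite lerXn2r ?expR_ge1Dx // nnegrE ?expR_ge0 ?addr_ge0 ?divr_ge0 // ltW.
rewrite -expRM_natl ler_expR mulrA ler_pdivrMr // -subn1 natrB; last first.
  exact: leq_trans n3.
have : 4 <= n%:R :> R by rewrite ler_nat.
lra.
Qed.

Lemma derangement_poincare n (f : 'S_n -> R) : (3 < n)%N ->
  \sum_(s | is_derangement s) f s = 0 ->
  \sum_(s | is_derangement s) f s ^+ 2 <=
  expR 322 / (2 * n%:R) * energy (@is_derangement n) f.
Proof.
move=> n3 f0; have [F [Ff F_le]] := derangement_extension f n3.
case: n => // n in n3 f f0 F Ff F_le *.
have fact0 : 0 < (n.+1)`!%:R :> R by rewrite ltr0n fact_gt0.
(* Centring at the mean of [F] over all permutations can only increase the sum of squares of the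
   mean-zero [f]. *)
pose m := (\sum_s F s) / (n.+1)`!%:R.
apply: (@le_trans _ _ (\sum_(s | is_derangement s) (f s - m) ^+ 2)).
  under [leRHS]eq_bigr do rewrite sqrrB.
  rewrite !big_split /= sumrN sumrMnl -mulr_suml f0 mul0r mul0rn subr0 lerDl.
  by apply: sumr_ge0 => s _; apply: sqr_ge0.
apply: (@le_trans _ _ (\sum_s (F s - m) ^+ 2)).
  rewrite [leLHS]big_mkcond; apply: ler_sum => s _.
  by case: ifP => [/Ff ->|_] //; apply: sqr_ge0.
have -> : \sum_s (F s - m) ^+ 2 =
   \sum_s F s ^+ 2 - (\sum_s F s) ^+ 2 / (n.+1)`!%:R.
  under eq_bigr do rewrite sqrrB.
  rewrite !big_split /= sumrN sumrMnl -mulr_suml sumr_const.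
  rewrite card_predT_perm -[m ^+ 2 *+ _]mulr_natr /m.
  by field; rewrite gt_eqF.
apply: le_trans (symmetric_group_poincare F) _.
rewrite [expR _ / _]mulrC -mulrA ler_wpM2l // invr_ge0 mulr_ge0 //.
Qed.

Lemma derangement_log_sobolev n (f : 'S_n -> R) : (3 < n)%N ->
  entropy (@is_derangement n) (fun s => f s ^+ 2) <=
  (9 + 4 * ln n%:R) / (2 * n%:R) * expR 322 * energy (@is_derangement n) f.
Proof.
move=> n3; have [F [Ff F_le]] := derangement_extension f n3.
case: n => // n in n3 f F Ff F_le *.
have C0 : 0 <= (9 + 4 * ln n.+1%:R) / (2 * n.+1%:R) :> R.
  by rewrite divr_ge0 ?mulr_ge0 // addr_ge0 // mulr_ge0 // ln_ge0 // ler1n.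
rewrite -mulrA; apply: le_trans (ler_wpM2l C0 F_le).
apply: le_trans (symmetric_group_log_sobolev F).
have p0 : (0 < #|(predT : pred 'S_n.+1)|)%N by rewrite card_predT_perm fact_gt0.
(* The constant optimal for [F ^+ 2] on all permutations also serves for derangements. [entropy_le]
   asks for [0 < c], so [c = 0], where everything vanishes, is separate. *)
rewrite [leRHS]entropy_attained //; set c := _ / _.
have F2 s : 0 <= F s ^+ 2 by apply: sqr_ge0.
have c0 : 0 <= c by rewrite divr_ge0 // sumr_ge0.
have [c00|cn0] := eqVneq c 0.
  have F0 s : F s = 0.
    move/eqP: c00; rewrite mulf_eq0 invr_eq0 pnatr_eq0 (gtn_eqF p0) orbF.
    rewrite psumr_eq0 // => /allP /(_ s); rewrite mem_index_enum.
    by move=> /(_ isT); rewrite sqrf_eq0 => /eqP.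
  rewrite c00 [leRHS]big1 => [|s _]; last first.
    by rewrite F0 expr0n /= !mul0r !subr0 addr0.
  rewrite /entropy big1 => [|s /Ff <-]; last by rewrite F0 expr0n /= mul0r.
  by rewrite big1 ?mul0r ?subr0 // => s /Ff <-; rewrite F0 expr0n.
have {cn0}cpos : 0 < c by rewrite lt_neqAle eq_sym cn0.
apply: le_trans (entropy_le _ (fun s => sqr_ge0 (f s)) cpos) _.
rewrite [leLHS]big_mkcond; apply: ler_sum => s _.
by case: ifP => [/Ff ->|_] //; apply: entropy_integrand_ge0.
Qed.

End Derangements.

(** * Simplicity of the eigenvalue 1 *)

Section SimpleEigenvalue.
Context {F : fieldType}.

Lemma ublock1_unitmx n (v : 'M[F]_(1, n)) :
  block_mx 1%:M v 0 1%:M \in unitmx.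
Proof. by rewrite unitmxE det_ublock !det1 mulr1 unitr1. Qed.

Lemma char_poly_conj n (A B P : 'M[F]_n) : P \in unitmx -> P *m A = B *m P ->
  char_poly A = char_poly B.
Proof.
rewrite unitmxE unitfE => dP PA; pose Pp := map_mx polyC P.
have dPp : \det Pp != 0 by rewrite det_map_mx polyC_eq0.
apply: (mulfI dPp); rewrite /= [RHS]mulrC -!det_mulmx.
congr (\det _); rewrite /char_poly_mx mulmxBr mulmxBl -!map_mxM PA.
by rewrite -scalar_mxC.
Qed.

(** In a basis starting with [e] the matrix is block lower triangular with corner 1, so it suffices
    that its other diagonal block [B] lacks the eigenvalue 1. This bounds the algebraic
    multiplicity. *)
Lemma mup1_char_poly_le1 n (A : 'M[F]_(1 + n)) (e := const_mx 1 : 'rV_(1 + n)) :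
  e *m A = e -> A *m e^T = e^T -> e *m e^T != 0 ->
  (forall v : 'rV_(1 + n), v *m A = v -> v *m e^T = 0 -> v = 0) ->
  (mup 1 (char_poly A) <= 1)%N.
Proof.
move=> eA Ae ee ker0.
pose P : 'M[F]_(1 + n) := block_mx 1%:M (const_mx 1) 0 1%:M.
have Pu : P \in unitmx by apply: ublock1_unitmx.
pose C := P *m A *m invmx P; have PA : P *m A = C *m P by rewrite mulmxKV.
have e1P : row_mx 1%:M 0 *m P = e.
  rewrite /P mul_row_block !mul1mx !mul0mx !addr0 /e -row_mx_const.
  by congr row_mx; apply/matrixP => i j; rewrite !ord1 !mxE.
have e1C : row_mx 1%:M 0 *m C = row_mx 1%:M 0.
  by rewrite /C !mulmxA e1P eA -e1P mulmxK.
have CE : C = block_mx 1%:M 0 (dlsubmx C) (drsubmx C).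
  rewrite -[LHS]submxK.
  have := e1C; rewrite -[C in LHS]submxK mul_row_block !mul1mx !mul0mx !addr0.
  by case/eq_row_mx => -> ->.
set B := drsubmx C in CE.
have charE : char_poly A = ('X - 1%:P) * char_poly B.
  rewrite (char_poly_conj Pu PA) CE /char_poly /char_poly_mx.
  rewrite map_block_mx scalar_mx_block opp_block_mx add_block_mx.
  rewrite !map_mx0 oppr0 addr0 add0r.
  by rewrite det_lblock det_mx11 !mxE.
rewrite charE mupMl; first by rewrite -['X - _]expr1 mup_XsubCX eqxx.
apply/negP; rewrite -eigenvalue_root_char => /eigenvalueP[u].
rewrite scale1r => uB /negP; apply; apply/eqP.
pose v := row_mx 0 u *m P; pose t := u *m dlsubmx C.
have vA : v *m A = t *m e + v.
  rewrite /v -mulmxA PA mulmxA CE mul_row_block !mul0mx !add0r uB -e1P mulmxA.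
  by rewrite mul_mx_row mulmx1 mulmx0 -mulmxDl add_row_mx addr0 add0r.
(* Pairing with the right eigenvector [e^T] kills the [e] component, so [v] is itself fixed by
   [A]. *)
have te : t *m e = 0.
  have : v *m A *m e^T = v *m e^T by rewrite -mulmxA Ae.
  rewrite vA mulmxDl -[RHS]add0r => /addIr; rewrite -mulmxA => tee.
  suff -> : t = 0 by rewrite mul0mx.
  move: ee tee; rewrite [t]mx11_scalar mul_scalar_mx => ee /eqP.
  rewrite scaler_eq0 (negPf ee) orbF => /eqP ->.
  by apply/matrixP => i j; rewrite !ord1 !mxE mul0rn.
rewrite te add0r in vA.
pose a := (v *m e^T) 0 0 / (e *m e^T) 0 0.
have ee0 : (e *m e^T) 0 0 != 0.
  by apply: contraNneq ee => ee0; apply/eqP/matrixP => i j; rewrite !ord1 ee0 mxE.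
have : v - a *: e = 0.
  apply: ker0; first by rewrite mulmxBl vA -scalemxAl eA.
  rewrite mulmxBl -scalemxAl; rewrite [v *m e^T]mx11_scalar [e *m e^T]mx11_scalar.
  by rewrite scale_scalar_mx divfK // subrr.
rewrite -e1P /v scalemxAl -mulmxBl => /(congr1 (mulmx^~ (invmx P))).
rewrite mulmxK // mul0mx scale_row_mx opp_row_mx add_row_mx -row_mx0.
by case/eq_row_mx => _; rewrite scaler0 subr0.
Qed.

End SimpleEigenvalue.

(** * Spectral gap from a Poincare inequality *)

Section SpectralGap.
Context {R : realType} {X : finType} (P : X -> X -> R).
Hypothesis P_sym : forall x y, P x y = P y x.
Hypothesis P_row : forall x, \sum_y P x y = 1.

Lemma dirichlet_form_sym (f : X -> R) :
  2^-1 * (\sum_x \sum_y (f x - f y) ^+ 2 * P x y) =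
  \sum_x f x ^+ 2 - \sum_y (\sum_x f x * P x y) * f y.
Proof.
have -> : \sum_x \sum_y (f x - f y) ^+ 2 * P x y =
    \sum_x \sum_y f x ^+ 2 * P x y + \sum_x \sum_y f y ^+ 2 * P x y -
    2 * \sum_x \sum_y f x * P x y * f y.
  rewrite mulr_sumr -sumrN -!big_split; apply: eq_bigr => x _ /=.
  rewrite mulr_sumr -sumrN -!big_split; apply: eq_bigr => y _ /=.
  by ring.
have -> : \sum_x \sum_y f x ^+ 2 * P x y = \sum_x f x ^+ 2.
  by apply: eq_bigr => x _; rewrite -mulr_sumr P_row mulr1.
have -> : \sum_x \sum_y f y ^+ 2 * P x y = \sum_x f x ^+ 2.
  rewrite exchange_big; apply: eq_bigr => x _ /=; rewrite -mulr_sumr.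
  by under eq_bigr do rewrite P_sym; rewrite P_row mulr1.
have -> : \sum_y (\sum_x f x * P x y) * f y = \sum_x \sum_y f x * P x y * f y.
  by rewrite exchange_big; apply: eq_bigr => y _; rewrite mulr_suml.
by field.
Qed.

Variable c : R.
Hypothesis c_gt0 : 0 < c.
Hypothesis poincare : forall f : X -> R, \sum_x f x = 0 ->
  c * \sum_x f x ^+ 2 <= 2^-1 * \sum_x \sum_y (f x - f y) ^+ 2 * P x y.

Let M := kernel_mx P.

Let vecf (v : 'rV[R]_#|X|) x := v 0 (enum_rank x).

Let sum_ord (g : 'I_#|X| -> R) : \sum_i g i = \sum_x g (enum_rank x).
Proof.
rewrite (reindex enum_rank) //.
by exists enum_val => x _; rewrite ?enum_rankK ?enum_valK.
Qed.

Let vecf_mul v y : vecf (v *m M) y = \sum_x vecf v x * P x y.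
Proof.
rewrite /vecf mxE sum_ord; apply: eq_bigr => x _.
by rewrite mxE !enum_rankK.
Qed.

Let eigenvector_le v a : v *m M = a *: v -> \sum_x vecf v x = 0 -> v != 0 ->
  a <= 1 - c.
Proof.
move=> vM v0 vn0; have := poincare v0; rewrite dirichlet_form_sym.
have -> : \sum_y (\sum_x vecf v x * P x y) * vecf v y =
   a * \sum_x vecf v x ^+ 2.
  rewrite mulr_sumr; apply: eq_bigr => y _.
  by rewrite -vecf_mul vM /vecf mxE -mulrA -expr2.
set S := \sum_x _; suff S0 : 0 < S by rewrite -[X in X - _]mul1r -mulrBl ler_pM2r //; lra.
have [i vi] : exists i, v 0 i != 0.
  apply/existsP; apply: contraNT vn0 => /existsPn v0i.
  by apply/eqP/rowP => i; rewrite mxE; apply/eqP; rewrite -[_ == _]negbK v0i.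
rewrite /S (bigD1 (enum_val i)) //= ltr_pwDl //.
  by rewrite /vecf enum_valK exprn_even_gt0.
by apply: sumr_ge0 => x _; apply: sqr_ge0.
Qed.

Let sum_vecf_mul v : \sum_y vecf (v *m M) y = \sum_x vecf v x.
Proof.
under eq_bigr do rewrite vecf_mul; rewrite exchange_big.
by apply: eq_bigr => x _; rewrite -mulr_sumr P_row mulr1.
Qed.

(** [M] preserves coordinate sums, so an eigenvector for [a != 1] sums to zero and the Poincare
    hypothesis applies. *)
Lemma root_char_poly_le a : root (char_poly M) a -> a != 1 -> a <= 1 - c.
Proof.
rewrite -eigenvalue_root_char => /eigenvalueP[v vM vn0] a1.
apply: (eigenvector_le vM _ vn0); apply/eqP.
have := sum_vecf_mul v; rewrite vM.
under eq_bigr do rewrite /vecf mxE.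
rewrite -mulr_sumr -[RHS]mul1r => /eqP; rewrite -subr_eq0 -mulrBl mulf_eq0.
by rewrite subr_eq0 (negPf a1).
Qed.

Lemma mup1_kernel_mx_le1 : (mup 1 (char_poly M) <= 1)%N.
Proof.
have [X0|Xn0] := eqVneq #|X| 0%N.
  rewrite mupNroot // -eigenvalue_root_char; apply/negP => /eigenvalueP[v _].
  by apply/negP; rewrite negbK; apply/eqP/rowP => i; have := ltn_ord i; rewrite [X in (_ < X)%N]X0.
have M_rowsum i : \sum_j M i j = 1.
  rewrite sum_ord -(P_row (enum_val i)); apply: eq_bigr => y _.
  by rewrite mxE enum_rankK.
have M_colsum j : \sum_i M i j = 1.
  by rewrite -(M_rowsum j); apply: eq_bigr => i _; rewrite !mxE P_sym.
have M_ker (v : 'rV_#|X|) : v *m M = v -> \sum_i v 0 i = 0 -> v = 0.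
  move=> vM v0; apply/eqP; apply: contraT => vn0.
  have : 1 <= 1 - c; last by rewrite lerBrDr gerDl leNgt c_gt0.
  by apply: eigenvector_le vn0; rewrite ?scale1r // -sum_ord.
(* The size is rewritten as [1 + n] to allow the block decomposition. *)
move: M M_rowsum M_colsum M_ker; rewrite -(prednK (n := #|X|)) ?lt0n //.
move: #|X|.-1 => n A rowsum colsum ker0.
have dot (v : 'rV[R]_(1 + n)) : v *m (const_mx 1)^T = (\sum_i v 0 i)%:M.
  apply/matrixP => i j; rewrite !ord1 !mxE; apply: eq_bigr => l _.
  by rewrite !mxE mulr1.
apply: (@mup1_char_poly_le1 R n A).
- apply/rowP => j; rewrite !mxE -[RHS](colsum j); apply: eq_bigr => i _.
  by rewrite mxE mul1r.
- apply/colP => i; rewrite !mxE -[RHS](rowsum i); apply: eq_bigr => j _.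
  by rewrite !mxE mulr1.
- rewrite dot; under eq_bigr do rewrite mxE.
  rewrite sumr_const card_ord; apply/negP => /eqP /matrixP /(_ 0 0).
  by rewrite !mxE => /eqP; rewrite pnatr_eq0.
- move=> v vA; rewrite dot => /matrixP /(_ 0 0); rewrite !mxE /= => v0.
  exact: ker0.
Qed.

Lemma spectral_gap_ge : c <= 1 -> c <= spectral_gap P.
Proof.
move=> c1; rewrite /spectral_gap lerBrDr -lerBrDl /beta /eigenvalues.
set p := char_poly (kernel_mx P); set s := flatten _.
have p0 : p != 0 by apply/monic_neq0/char_poly_monic.
(* With fewer than two listed eigenvalues [beta P 1] is the default 0, and [c <= 1] suffices. *)
have [|s1] := leqP (size (sort >=%R s)) 1.
  by move=> s1; rewrite nth_default // subr_ge0.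
rewrite leNgt; apply/negP => lt_s1.
pose large x := 1 - c < x.
(* Only the eigenvalue 1 can exceed [1 - c], and it is simple; a large second entry would force two
   large entries. *)
have cnt : (count large s <= 1)%N.
  rewrite count_flatten -map_comp.
  have -> : sumn [seq (count large \o (fun x => nseq (mup x p) x)) x | x <- rootsR p] =
    (\sum_(x <- rootsR p) large x * mup x p)%N.
    by rewrite sumnE big_map; apply: eq_bigr => x _; rewrite /= count_nseq.
  rewrite (bigID (pred1 1)) /= [X in (_ + X)%N]big_seq_cond.
  rewrite [X in (_ + X)%N]big1 => [|x /andP[]]; last first.
    rewrite -(roots_on_rootsR p0) => /andP[_ xp] x1.
    by rewrite /large ltNge root_char_poly_le.
  rewrite addn0; have [r1|r1] := boolP (1 \in rootsR p); last first.
    rewrite big_seq_cond big1 // => x /andP[xp /eqP x1].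
    by rewrite x1 (negPf r1) in xp.
  rewrite -big_filter filter_pred1_uniq ?uniq_roots // big_seq1.
  apply: leq_trans mup1_kernel_mx_le1.
  by case: (large 1); rewrite ?mul1n.
have := count_sort >=%R large s.
have : sorted >=%R (sort >=%R s) by apply: sort_sorted => x y; apply: le_total.
move: s1 lt_s1; case: (sort _ _) => [|x [|y r]] //= _ ys /andP[yx _].
by move: cnt => /[swap] <-; rewrite /large ys (lt_le_trans ys yx).
Qed.

End SpectralGap.

(** * The Metropolized walk *)

Section DerangementWalk.
Context {R : realType}.

(** A transposition comes from at most two ordered pairs; the diagonal gives [g 1 = 0]. *)
Lemma sum_tperm_le n (g : 'S_n -> R) : (forall t, 0 <= g t) -> g 1%g = 0 ->
  \sum_a \sum_b g (tperm a b) <= 2 * \sum_(t | is_transposition t) g t.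
Proof.
move=> g0 g1.
have -> : \sum_a \sum_b g (tperm a b) =
    \sum_t \sum_(p : 'I_n * 'I_n | (p.1 != p.2) && (tperm p.1 p.2 == t)) g t.
  rewrite pair_big /= (bigID (fun p => p.1 == p.2)) /=.
  rewrite big1 ?add0r => [|p /eqP ->]; last by rewrite tperm1.
  rewrite (partition_big (fun p => tperm p.1 p.2) predT) //=.
  by apply: eq_bigr => t _; apply: eq_bigr => p /andP[_ /eqP ->].
rewrite mulr_sumr [leRHS]big_mkcond; apply: ler_sum => t _.
case: ifP => [/existsP[i /existsP[j /andP[ij /eqP ->]]]|tN].
  rewrite sumr_const -[_ *+ _]mulr_natl ler_wpM2r // ler_nat.
  apply: leq_trans (card_size [:: (i, j); (j, i)]).
  apply/subset_leq_card/fintype.subsetP => -[a b] /andP[/= ab /eqP E].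
  have := congr1 (fun s : 'S_n => s a) E; rewrite tpermL !inE.
  case: tpermP => [-> ->|-> ->|_ _ ba]; rewrite ?eqxx ?orbT //.
  by rewrite ba eqxx in ab.
rewrite big_pred0 // => -[a b]; apply/negP => /andP[/= ab /eqP E].
suff tT : is_transposition t by rewrite tT in tN.
by apply/existsP; exists a; apply/existsP; exists b; rewrite ab E eqxx.
Qed.

Lemma is_transpositionV n (t : 'S_n) : is_transposition t^-1 = is_transposition t.
Proof.
suff imp s : @is_transposition n s -> is_transposition s^-1.
  by apply/idP/idP => [/imp|/imp //]; rewrite invgK.
move=> /existsP[i /existsP[j /andP[ij /eqP ->]]]; apply/existsP; exists i.
by apply/existsP; exists j; rewrite ij tpermV eqxx.
Qed.

Lemma is_transposition1 n : is_transposition (1 : 'S_n)%g = false.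
Proof.
apply: negbTE; apply/negP => /existsP[i /existsP[j /andP[ij /eqP E]]].
by have := congr1 (fun s : 'S_n => s i) E; rewrite perm1 tpermL => /eqP; apply/negP.
Qed.

Lemma transp_adjC n (x y : 'S_n) : transp_adj x y = transp_adj y x.
Proof. by rewrite /transp_adj -is_transpositionV invMg invgK. Qed.

Lemma transp_adj_refl n (x : 'S_n) : transp_adj x x = false.
Proof. by rewrite /transp_adj mulgV is_transposition1. Qed.

Lemma sum_derangements n (g : 'S_n -> R) :
  \sum_(x : derangement n) g (val x) = \sum_(s | is_derangement s) g s.
Proof.
rewrite [RHS](reindex_omap (val : derangement n -> 'S_n) insub) /= => [|s Ds].
  by apply: eq_bigl => x; rewrite (valP x) valK eqxx.
by rewrite insubT.
Qed.

(** The cyclic shift and its inverse differ, as two shifts send 0 to 2. *)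
Lemma card_derangement_gt1 n : (2 < n)%N -> (1 < #|@is_derangement n|)%N.
Proof.
case: n => // n n2; pose r := perm (can_inj (@ordSK n.+1)).
have rE i : r i = (i.+1 %% n.+1)%N :> nat by rewrite permE.
have r_der i : r i != i.
  rewrite -val_eqE /= rE; have := ltn_ord i; rewrite leq_eqVlt.
  case/predU1P => [iE|lt_in].
    by rewrite iE modnn eq_sym -lt0n; rewrite -ltnS iE; exact: ltn_trans n2.
  by rewrite modn_small // gtn_eqF.
apply/card_gt1P; exists r, r^-1%g; split; first exact/forallP.
  apply/forallP => i; apply: contra (r_der i) => /eqP rV.
  by rewrite -{1}rV permKV.
apply/eqP => /permP /(_ (r ord0)); rewrite permK => /(congr1 val).
by rewrite /= rE /= rE modn_small ?modn_small //; exact: ltn_trans n2.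
Qed.

Variable n : nat.
Hypothesis n_gt3 : (3 < n)%N.

Let d : R := 'C(n, 2)%:R.

Let n_gt0 : 0 < n%:R :> R.
Proof. by rewrite ltr0n (leq_trans _ n_gt3). Qed.

Let d_gt0 : 0 < d.
Proof. by rewrite ltr0n bin_gt0 (leq_trans _ n_gt3). Qed.

Let dE : 4 * d = 2 * n%:R * (n%:R - 1).
Proof.
have : 'C(n, 2)%:R * 2 = n%:R * (n%:R - 1) :> R.
  rewrite -natrM (bin_ffact n 2) ffactnS ffactn1 natrM -subn1 natrB //.
  exact: leq_trans n_gt3.
by rewrite /d; lra.
Qed.

Lemma Q_sym (x y : derangement n) : Q R x y = Q R y x.
Proof. by rewrite /Q eq_sym; case: eqP => [->//|_]; rewrite transp_adjC. Qed.

Lemma Q_adj (x y : derangement n) : transp_adj (val x) (val y) ->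
  Q R x y = (2 * d)^-1.
Proof.
by rewrite /Q; case: eqP => [->|_]; [rewrite transp_adj_refl | move=> ->].
Qed.

Lemma Q_row (x : derangement n) : \sum_y Q R x y = 1.
Proof.
rewrite (bigD1 x) //= {1}/Q eqxx -/d.
suff -> : \sum_(y | y != x) Q R x y =
    (2 * d)^-1 * #|[pred z : derangement n | transp_adj (val z) (val x)]|%:R.
  by rewrite subrK.
rewrite mulr_natr -sumr_const [RHS]big_mkcond [LHS]big_mkcond.
apply: eq_bigr => y _; rewrite inE transp_adjC /Q eq_sym.
by have [->|_] := eqVneq x y; rewrite ?transp_adj_refl.
Qed.

(** The value 0 off derangements is never seen by sums restricted to [is_derangement]. *)
Definition extend0 (f : derangement n -> R) (s : 'S_n) : R := oapp f 0 (insub s).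

Lemma extend0_val f x : extend0 f (val x) = f x.
Proof. by rewrite /extend0 valK. Qed.

Let form (f : derangement n -> R) : R := \sum_x \sum_y (f x - f y) ^+ 2 * Q R x y.

(** The factor is 2 for ordered pairs [(a, b)] times [2 * d], the inverse of an off-diagonal entry
    of [Q]. *)
Lemma energy_extend0_le f :
  energy (@is_derangement n) (extend0 f) <= 4 * d * form f.
Proof.
rewrite /energy -(sum_derangements (fun s => \sum_a \sum_(b | is_derangement
   (tperm a b * s)%g) (extend0 f s - extend0 f (tperm a b * s)%g) ^+ 2)).
rewrite mulr_sumr; apply: ler_sum => x _; rewrite mulr_sumr.
pose g (t : 'S_n) : R := if is_derangement (t * val x)%g
  then (extend0 f (val x) - extend0 f (t * val x)%g) ^+ 2 else 0.
apply: (@le_trans _ _ (\sum_a \sum_b g (tperm a b))).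
  by apply: ler_sum => a _; rewrite big_mkcond.
apply: le_trans (sum_tperm_le _ _) _ => [t||].
- by rewrite /g; case: ifP => // _; apply: sqr_ge0.
- by rewrite /g mul1g subrr expr0n if_same.
rewrite mulr_sumr (reindex_inj (mulIg (val x)^-1%g)) /=.
rewrite big_mkcond /=.
pose h s := if transp_adj s (val x) then
  2 * (extend0 f (val x) - extend0 f s) ^+ 2 else 0.
apply: (@le_trans _ _ (\sum_(s | is_derangement s) h s)).
  rewrite [leRHS]big_mkcond; apply: ler_sum => s _.
  rewrite /g mulgKV /h /transp_adj; case: ifP => _; last by case: ifP.
  by case: ifP => // _; rewrite mulr0.
rewrite -sum_derangements; apply: ler_sum => y _; rewrite /h.
have Q0 : 0 <= (f x - f y) ^+ 2 * Q R x y.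
  have [->|xy] := eqVneq x y; first by rewrite subrr expr0n mul0r.
  apply: mulr_ge0; first exact: sqr_ge0.
  rewrite /Q (negPf xy); case: ifP => // _; rewrite invr_ge0 mulr_ge0 //.
case: ifP => [xy|_]; last by rewrite mulr_ge0 // mulr_ge0 // ltW.
rewrite !extend0_val Q_adj 1?transp_adjC //.
rewrite le_eqVlt; apply/orP; left; apply/eqP.
by field; rewrite gt_eqF.
Qed.

Let form_ge0 f : 0 <= form f.
Proof.
rewrite -(@pmulr_rge0 _ (4 * d)) ?mulr_gt0 //.
exact: le_trans (energy_ge0 _ _) (energy_extend0_le f).
Qed.

Let C : R := expR 322.

Let C_ge1 : 1 <= C.
Proof. by rewrite /C; apply: le_trans (expR_ge1Dx _); lra. Qed.

Lemma gap_Q : (44 * C)^-1 / n%:R <= spectral_gap (@Q R n).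
Proof.
have C1 := C_ge1; have n4 : 4 <= n%:R :> R by rewrite ler_nat.
have C0 : 0 < C by lra.
apply: spectral_gap_ge Q_sym Q_row _ _ _ _.
- by rewrite divr_gt0 // invr_gt0 mulr_gt0.
- move=> f f0; rewrite -/(form f).
  have sum1 : \sum_(s | is_derangement s) extend0 f s = 0.
    by rewrite -sum_derangements -[RHS]f0; apply: eq_bigr => x _; rewrite extend0_val.
  have sum2 : \sum_(s | is_derangement s) extend0 f s ^+ 2 = \sum_x f x ^+ 2.
    rewrite -(sum_derangements (fun s => extend0 f s ^+ 2)).
    by apply: eq_bigr => x _; rewrite extend0_val.
  have := derangement_poincare n_gt3 sum1; rewrite sum2 => le1.
  have CC : 0 <= C / (2 * n%:R) by rewrite divr_ge0 ?mulr_ge0 // ltW.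
  have := le_trans le1 (ler_wpM2l CC (energy_extend0_le f)).
  rewrite dE; set S := \sum_x _.
  have -> : C / (2 * n%:R) * (2 * n%:R * (n%:R - 1) * form f) =
     C * (n%:R * form f - form f) by field; rewrite gt_eqF.
  move=> S_le; rewrite -invfM mulrC ler_pdivrMr ?mulr_gt0 //.
  apply: le_trans S_le _.
  have -> : 2^-1 * form f * (44 * C * n%:R) = C * (22 * n%:R * form f).
    by field.
  rewrite ler_pM2l //; have := form_ge0 f => F0.
  have := mulr_ge0 (ltW n_gt0) F0; lra.
- rewrite -invfM invf_le1 ?mulr_gt0 //.
  by rewrite -[X in X <= _]mulr1 ler_pM //; lra.
Qed.

Lemma uniform_derangement (x : derangement n) :
  uniform_dist R x = #|@is_derangement n|%:R^-1.
Proof. by rewrite /uniform_dist card_sig. Qed.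

Lemma entropy2_uniform (f : derangement n -> R) :
  entropy2 (@uniform_dist R (derangement n)) f =
  entropy (@is_derangement n) (fun s => extend0 f s ^+ 2) /
    #|@is_derangement n|%:R.
Proof.
pose m := (\sum_(s | is_derangement s) extend0 f s ^+ 2) / #|@is_derangement n|%:R.
have sum_val (g : R -> R) : \sum_x g (f x) =
    \sum_(s | is_derangement s) g (extend0 f s).
  rewrite -(sum_derangements (fun s => g (extend0 f s))).
  by apply: eq_bigr => x _; rewrite extend0_val.
have normE : sqnorm2 (@uniform_dist R (derangement n)) f = m.
  rewrite /sqnorm2 /m -(sum_val (fun y => y ^+ 2)) mulr_suml.
  by apply: eq_bigr => x _; rewrite uniform_derangement real_normK ?num_real.
(* Positivity of [m] lets the logarithm of the quotient split; points with [f x = 0] contribute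
   nothing. *)
have fm x : f x != 0 -> 0 < m.
  move=> fx; have Dx := valP x; rewrite divr_gt0 ?ltr0n //.
    rewrite (bigD1 (val x)) //= extend0_val ltr_pwDl ?exprn_even_gt0 //.
    by apply: sumr_ge0 => s _; apply: sqr_ge0.
  by apply/card_gt0P; exists (val x).
rewrite /entropy2 /entropy normE -/m mulrBl !mulr_suml -sumrB.
rewrite -(sum_val (fun y => y ^+ 2 * ln (y ^+ 2) / _ - y ^+ 2 * ln m / _)).
apply: eq_bigr => x _; rewrite uniform_derangement real_normK ?num_real //.
have [->|fx] := eqVneq (f x) 0; first by rewrite expr0n /= !mul0r subrr.
by rewrite ln_div ?posrE ?exprn_even_gt0 ?(fm x) // -mulrBl mulrBr.
Qed.

Lemma log_sobolev_Q :
  (44 * C)^-1 / (n%:R * ln n%:R) <=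
    log_sobolev (@Q R n) (@uniform_dist R (derangement n)).
Proof.
have card1 := card_derangement_gt1 (ltnW n_gt3).
have D0 : 0 < #|@is_derangement n|%:R :> R by rewrite ltr0n (ltn_trans _ card1).
have q0 (f : derangement n -> R) s : 0 <= extend0 f s ^+ 2 by apply: sqr_ge0.
rewrite /log_sobolev; apply: lb_le_inf.
  (* The infimum is over a nonempty set: the indicator of one derangement has entropy [ln N / N],
     with [N > 1] the number of derangements. *)
  have [s0 [_ [Ds0 _ _]]] := card_gt1P card1.
  pose x0 : derangement n := exist _ s0 Ds0; pose f y : R := (y == x0)%:R.
  exists (dirichlet (@Q R n) (@uniform_dist R _) f /
          entropy2 (@uniform_dist R _) f); exists f => //.
  have f_at y : y != x0 -> f y = 0 by rewrite /f => /negPf ->.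
  have f0 : f x0 = 1 by rewrite /f eqxx.
  have norm1 : sqnorm2 (@uniform_dist R (derangement n)) f =
      #|@is_derangement n|%:R^-1.
    rewrite /sqnorm2 (bigD1 x0) //= big1 ?addr0 => [|y /f_at ->].
      by rewrite f0 normr1 expr1n mul1r uniform_derangement.
    by rewrite normr0 expr0n mul0r.
  rewrite /entropy2 norm1 (bigD1 x0) //= big1 ?addr0 => [|y /f_at ->].
    rewrite f0 normr1 expr1n !mul1r invrK uniform_derangement.
    by rewrite mulf_neq0 ?invr_neq0 ?gt_eqF // ln_gt0 // ltr1n.
  by rewrite normr0 expr0n !mul0r.
move=> _ [f fn0 ->]; move: fn0; rewrite entropy2_uniform.
have := derangement_log_sobolev (extend0 f) n_gt3.
have := entropy_ge0 (@is_derangement n) (q0 f).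
set H := entropy _ _; set N : R := #|_|%:R in D0 * => H0 H_le HN.
have Hpos : 0 < H.
  by rewrite lt_neqAle H0 andbT eq_sym; apply: contraNneq HN => ->; rewrite mul0r.
have -> : dirichlet (@Q R n) (@uniform_dist R (derangement n)) f =
    2^-1 * form f / N.
  rewrite /dirichlet -mulrA /form mulr_suml; congr (_ * _).
  apply: eq_bigr => x _; rewrite mulr_suml; apply: eq_bigr => y _.
  by rewrite uniform_derangement real_normK ?num_real.
have C1 := C_ge1; have C0 : 0 < C by lra.
have n4 : 4 <= n%:R :> R by rewrite ler_nat.
have ln_ge : 2^-1 <= ln n%:R :> R.
  have ninv : 0 < n%:R^-1 :> R by rewrite invr_gt0.
  have := ln_le_sub1 ninv; rewrite lnV ?posrE //.
  have : n%:R^-1 <= 4^-1 :> R by rewrite lef_pV2 ?posrE.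
  lra.
set l : R := ln _ in H_le ln_ge *.
have l0 : 0 < l by lra.
have K0 : 0 <= (9 + 4 * l) / (2 * n%:R) * C.
  by rewrite mulr_ge0 ?divr_ge0 ?mulr_ge0 // ?ltW //; lra.
have {}H_le := le_trans H_le (ler_wpM2l K0 (energy_extend0_le f)).
have -> : 2^-1 * form f / N / (H / N) = 2^-1 * form f / H.
  by field; rewrite !gt_eqF.
rewrite ler_pdivlMr // -invfM mulrC ler_pdivrMr ?mulr_gt0 //.
apply: le_trans H_le _; rewrite dE.
have -> : (9 + 4 * l) / (2 * n%:R) * C * (2 * n%:R * (n%:R - 1) * form f) =
   C * (form f * ((9 + 4 * l) * (n%:R - 1))) by field; rewrite gt_eqF.
have -> : 2^-1 * form f * (44 * C * (n%:R * l)) =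
   C * (form f * (22 * l * n%:R)) by field.
rewrite ler_pM2l //; apply: ler_wpM2l; first exact: form_ge0.
(* [2^-1 <= l] gives [9 + 4 * l <= 22 * l]; this is the source of 44 = 2 * 22. *)
by apply: ler_pM; lra.
Qed.

End DerangementWalk.

Theorem corollary8 (R : realType) :
  exists (c : R) (n0 : nat), 0 < c /\
    forall n : nat, (n0 <= n)%N ->
      c / n%:R <= spectral_gap (@Q R n) /\
      c / (n%:R * ln n%:R) <= log_sobolev (@Q R n) (@uniform_dist R (derangement n)).
Proof.
exists (44 * expR 322)^-1, 4; split; first by rewrite invr_gt0 mulr_gt0 // expR_gt0.
by move=> n n4; split; [apply: gap_Q | apply: log_sobolev_Q].
Qed.
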